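(* Let $\mathcal{P}=He_1\oplus He_2$ be the free left $H$-module of rank two with basis $e_1,e_2$, equipped with an $H$-pseudoalgebra structure such that $$e_{1}\ast e_{1}=t_{1}\otimes1 \otimes_{H}e_{1}, \quad e_{2}\ast e_{2}=t_{2}\otimes1 \otimes_{H}e_{2}$$ with $t_1,t_2\in\mathbf{k}$ nonzero (and $e_1\ast e_2$, $e_2\ast e_1$ are arbitrary elements of $(H\otimes H)\otimes_H\mathcal{P}$). Then $\mathcal{P}$ is a left pre-Lie $H$-pseudoalgebra if and only if it is of one of the following types: (1) $e_{1}\ast e_{2}=0$, $e_{2}\ast e_{1}=0$; (2) $e_{1}\ast e_{2}=t_{1}\otimes1 \otimes_{H}e_{2}$, $e_{2}\ast e_{1}=t_{2}\otimes1 \otimes_{H}e_{1}$; (3) $e_{1}\ast e_{2}=t_{1}\otimes1 \otimes_{H}e_{2}$, $e_{2}\ast e_{1}=t_{1}\otimes1 \otimes_{H}e_{2}$; (4) $e_{1}\ast e_{2}=2t_{1}\otimes1 \otimes_{H}e_{2}$, $e_{2}\ast e_{1}=\frac{1}{2}t_{2}\otimes1 \otimes_{H}e_{1}+t_{1}\otimes1 \otimes_{H}e_{2}$; (5) $e_{1}\ast e_{2}=t_{2}\otimes1 \otimes_{H}e_{1}$, $e_{2}\ast e_{1}=t_{2}\otimes1 \otimes_{H}e_{1}$; (6) $e_{1}\ast e_{2}=t_{2}\otimes1 \otimes_{H}e_{1}$, $e_{2}\ast e_{1}=t_{1}\otimes1 \otimes_{H}e_{2}$; (7) $e_{1}\ast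 e_{2}=t_{2}\otimes1 \otimes_{H}e_{1}+\frac{1}{2}t_{1}\otimes1 \otimes_{H}e_{2}$, $e_{2}\ast e_{1}=2t_{2}\otimes1 \otimes_{H}e_{1}$; (8) $e_{1}\ast e_{2}=t_{2}\otimes1 \otimes_{H}e_{1}+2t_{1}\otimes1 \otimes_{H}e_{2}$, $e_{2}\ast e_{1}=2t_{2}\otimes1 \otimes_{H}e_{1}+t_{1}\otimes1 \otimes_{H}e_{2}$.
   Context: $\mathbf{k}$ is an algebraically closed field of characteristic $0$, $\delta$ is a finite-dimensional Lie algebra over $\mathbf{k}$, and $H=U(\delta)$ is its universal enveloping algebra with the standard cocommutative Hopf structure ($\Delta(x)=x\otimes1+1\otimes x$ for $x\in\delta$). We regard $\mathbf{k},\delta\subset H$. $H^{\otimes n}$ is a right $H$-module via the iterated coproduct, e.g. $(f\otimes g)\cdot h=(f\otimes g)\Delta(h)$. An $H$-pseudoalgebra is a left $H$-module $A$ with a map $\ast:A\otimes A\to(H\otimes H)\otimes_H A$ that is $H$-bilinear: $hx\ast gy=(h\otimes g\otimes_H1)(x\ast y)$ for $x,y\in A$, $h,g\in H$. For $\beta\in H\otimes H$ and $x\ast y=\sum_i\alpha_i\otimes_Hc_i$ one sets, in $H^{\otimes3}\otimes_HA$, $(\beta\otimes_Hx)\ast y=\sum_i(\beta\otimes1)(\Delta\otimes\mathrm{id})(\alpha_i)\otimes_Hc_i$ and $x\ast(\beta\otimes_Hy)=\sum_i(1\otimes\beta)(\mathrm{id}\otimes\Delta)(\alpha_i)\otimes_Hc_i$.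 $A$ is left pre-Lie if for all $x,y,z\in A$ $$(x\ast y)\ast z-x\ast(y\ast z)=((12)\otimes_H\mathrm{id})[(y\ast x)\ast z-y\ast(x\ast z)],$$ where $(12)(f\otimes h\otimes g)=h\otimes f\otimes g$. Conventions: $f\otimes g\otimes_He$ means $(f\otimes g)\otimes_He$. By $H$-bilinearity a pseudoproduct on a free module is determined by its values on basis elements. *)

(* Defs.v *)
From HB Require Import structures.
From mathcomp Require Import all_boot all_order all_algebra.
From mathcomp Require Import boolp classical_sets.
From mathcomp.multinomials Require Import freeg.

Set Implicit Arguments.
Unset Strict Implicit.
Unset Printing Implicit Defensive.

Import GRing.Theory.
Local Open Scope ring_scope.
Local Open Scope quotient_scope.

Reserved Notation "A '\ox' B" (at level 40, left associativity).
Reserved Notation "s '\ox_[' phi ] x"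
  (at level 40, left associativity, format "s  '\ox_[' phi ]  x").

(** * Tensor products over a possibly noncommutative ring

MathComp has no right modules: the right action of [R] on [M] is given by
[act]. The tensor product of [M] and [N] over [R] is the free abelian group on
[M * N] modulo the subgroup [trel] generated by the usual relations. *)

Section Tensor.
Context (R : pzRingType) (M : zmodType) (act : M -> R -> M) (N : lmodType R).

Inductive trel : {freeg (M * N) / int} -> Prop :=
| trel0 : trel 0
| trelB u v : trel u -> trel v -> trel (u - v)
| trelDl m m' n : trel (<< (m + m', n) >> - (<< (m, n) >> + << (m', n) >>))
| trelDr m n n' : trel (<< (m, n + n') >> - (<< (m, n) >> + << (m, n') >>))
| trelZ m r n : trel (<< (act m r, n) >> - << (m, r *: n) >>).

Definition trelb : {pred {freeg (M * N) / int}} := fun u => `[< trel u >].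

Fact trelb_zmod_closed : zmod_closed trelb.
Proof.
split=> [|u v /asboolP hu /asboolP hv]; first exact/asboolP/trel0.
by apply/asboolP; apply: trelB.
Qed.

HB.instance Definition _ :=
  GRing.isZmodClosed.Build {freeg (M * N) / int} trelb trelb_zmod_closed.

Definition tensor : Type := {ideal_quot trelb}.

HB.instance Definition _ := GRing.Zmodule.on tensor.

Definition tpure (m : M) (n : N) : tensor :=
  \pi_({ideal_quot trelb}) << (m, n) >>.

Lemma tpureDl m m' n : tpure (m + m') n = tpure m n + tpure m' n.
Proof.
apply/eqP; rewrite /tpure -[X in _ == X]raddfD -Quotient.idealrBE.
exact/asboolP/trelDl.
Qed.

Lemma tpureDr m n n' : tpure m (n + n') = tpure m n + tpure m n'.
Proof.
apply/eqP; rewrite /tpure -[X in _ == X]raddfD -Quotient.idealrBE.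
exact/asboolP/trelDr.
Qed.

Lemma tpureZ m r n : tpure (act m r) n = tpure m (r *: n).
Proof.
by apply/eqP; rewrite /tpure -Quotient.idealrBE; apply/asboolP/trelZ.
Qed.

Lemma tpure0l n : tpure 0 n = 0.
Proof. by apply: (addrI (tpure 0 n)); rewrite -tpureDl !addr0. Qed.

Lemma tpureNl m n : tpure (- m) n = - tpure m n.
Proof. by apply/eqP; rewrite -addr_eq0 -tpureDl addNr tpure0l. Qed.

Lemma tpure_ind (P : tensor -> Prop) :
    P 0 -> (forall m n, P (tpure m n)) ->
    (forall u v, P u -> P v -> P (u + v)) -> forall u, P u.
Proof.
move=> P0 P1 PD u; rewrite -[u]reprK.
set D := repr u; rewrite -[D]freeg_sumE raddf_sum /=.
have PN v m n : P (tpure m n *+ v).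
  by elim: v => [|v IHv]; rewrite ?mulr0n // mulrS; apply: (PD).
elim: (dom D) => [|[m n] s IHs]; first by rewrite big_nil.
rewrite big_cons; apply: (PD) => //.
have -> z : << z *g (m, n) >> = << (m, n) >> *~ z :> {freeg (M * N) / int}.
  by rewrite freeg_mulz intz.
rewrite raddfMz; case: (coeff _ _) => z.
  exact: PN.
by rewrite NegzE mulrNz -mulNrz -tpureNl; apply: PN.
Qed.

(** Every balanced biadditive map [f] factors through the tensor product by
[tlift f], see [tliftE]; [tlift f] is meaningless for other [f]. *)

Context (G : zmodType).

Definition balanced (f : M -> N -> G) : Prop :=
  [/\ forall m m' n, f (m + m') n = f m n + f m' n,
      forall m n n', f m (n + n') = f m n + f m n'
    & forall m r n, f (act m r) n = f m (r *: n)].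

Definition tlift (f : M -> N -> G) (u : tensor) : G :=
  fglift (fun p => f p.1 p.2 : zmodule G) (repr (u : {ideal_quot trelb})).

Section Lift.
Context (f : M -> N -> G) (fP : balanced f).

Let L (D : {freeg (M * N) / int}) : G := fglift (fun p => f p.1 p.2 : zmodule G) D.

Let LB D1 D2 : L (D1 - D2) = L D1 - L D2. 
Proof.
exact: (@lift_is_additive int (M * N)%type (zmodule G) (fun p => f p.1 p.2)).
Qed.
Let L1 m n : L << (m, n) >> = f m n.
Proof. by rewrite /L liftU scale1r. Qed.

Let L_trel D : trel D -> L D = 0.
Proof.
have L0 : L 0 = 0 by have := LB 0 0; rewrite !subrr.
have LD D1 D2 : L (D1 + D2) = L D1 + L D2.
  by rewrite -{1}[D2]opprK LB -[- D2]sub0r LB L0 sub0r opprK.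
case: fP => fDl fDr fZ; elim=> [|u v _ Lu _ Lv|m m' n|m n n'|m r n].
- exact: L0.
- by rewrite LB Lu Lv subrr.
- by rewrite LB LD !L1 fDl subrr.
- by rewrite LB LD !L1 fDr subrr.
- by rewrite LB !L1 fZ subrr.
Qed.

Let L_pi D : tlift f (\pi_({ideal_quot trelb}) D) = L D.
Proof.
apply/eqP; rewrite -subr_eq0 -LB; apply/eqP/L_trel/asboolP.
by rewrite -[X in is_true X]/(_ \in trelb) Quotient.idealrBE reprK.
Qed.

Lemma tliftE m n : tlift f (tpure m n) = f m n.
Proof. by rewrite L_pi L1. Qed.

Lemma tlift_zmod_morphism : zmod_morphism (tlift f).
Proof.
move=> u v; rewrite -[u]reprK -[v]reprK -raddfB !L_pi.
exact: LB.
Qed.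

Lemma tlift0 : tlift f 0 = 0.
Proof. by have := tlift_zmod_morphism 0 0; rewrite !subrr. Qed.

Lemma tliftD : {morph tlift f : u v / u + v}.
Proof.
have B := tlift_zmod_morphism => u v.
by rewrite -{1}[v]opprK B -[- v]sub0r B tlift0 sub0r opprK.
Qed.

End Lift.
End Tensor.

(** * Tensor product of algebras over a field *)

Section SeparatingFunctional.
Context (k : fieldType) (V : lmodType k).

Lemma separating_functional (v : V) : v != 0 ->
  exists f : V -> k, (forall c x y, f (c *: x + y) = c * f x + f y) /\ f v = 1.
Proof.
move=> v0.
pose sub (W : set V) := ~ W v /\ forall c x y, W x -> W y -> W (c *: x + y).
have [|W [[Wv WL] Wmax]] := @Zorn_bigcup V sub.
  move=> F Fsub Ftot; split=> [[W FW Wv]|c x y [W1 F1 W1x] [W2 F2 W2y]].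
    by have [] := Fsub W FW.
  have [le12|le21] := Ftot _ _ F1 F2.
    by exists W2 => //; apply: (Fsub W2 F2).2 => //; apply: le12.
  by exists W1 => //; apply: (Fsub W1 F1).2 => //; apply: le21.
have W0 : W 0.
  apply: contrapT => nW0; apply: (Wmax (fun x => x = 0 \/ W x)).
    by split=> [x Wx|]; [right | move=> le; apply: nW0; apply: le; left].
  split=> [[/eqP|//]|c x y]; first by rewrite (negbTE v0).
  case=> [->|Wx] [->|Wy]; rewrite ?scaler0 ?addr0 ?add0r.
  - by left.
  - by right.
  - right; have -> : c *: x = (c - 1) *: x + x by rewrite scalerBl scale1r subrK.
    exact: WL.
  - by right; apply: WL.
have WZ c x : W x -> W (c *: x) by move=> Wx; rewrite -[_ *: _]addr0; apply: WL.
have WD x y : W x -> W y -> W (x + y).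
  by move=> Wx Wy; rewrite -[x]scale1r; apply: WL.
have WN x : W x -> W (- x) by move=> Wx; rewrite -scaleN1r; apply: WZ.
have Wcv c : W (c *: v) -> c = 0.
  move=> Wc; apply: contrapT => /eqP c0; apply: Wv.
  by rewrite -[v]scale1r -(mulVf c0) -scalerA; apply: WZ.
have cov x : exists c, W (x - c *: v).
  have [Wx|nWx] := pselect (W x).
    by exists 0; rewrite scale0r subr0.
  apply: contrapT => nc.
  apply: (Wmax (fun y => exists2 w, W w & exists c, y = w + c *: x)).
    split=> [y Wy|le]; first by exists y => //; exists 0; rewrite scale0r addr0.
    apply: nWx; apply: le; exists 0 => //.
    by exists 1; rewrite scale1r add0r.
  split=> [[w Ww [c vE]]|c y z [w Ww [d ->]] [w' Ww' [d' ->]]]; last first.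
    exists (c *: w + w'); first exact: WL.
    by exists (c * d + d'); rewrite scalerDr scalerA scalerDl addrACA.
  have c0 : c != 0.
    by apply/eqP => c0; apply: Wv; rewrite vE c0 scale0r addr0.
  apply: nc; exists c^-1.
  rewrite vE scalerDr scalerA mulVf // scale1r opprD addrCA subrr addr0.
  exact/WN/WZ.
pose f x := projT1 (cid (cov x)).
have fP x : W (x - f x *: v) by rewrite /f; case: cid.
have fE x c : W (x - c *: v) -> f x = c.
  move=> Wc; apply/eqP; rewrite -subr_eq0; apply/eqP/Wcv.
  have -> : (f x - c) *: v = (x - c *: v) - (x - f x *: v).
    by rewrite scalerBl opprB [RHS]addrC addrA subrK.
  exact/WD/WN.
exists f; split=> [c x y|]; last by apply: fE; rewrite scale1r subrr.
apply: fE.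
have -> : c *: x + y - (c * f x + f y) *: v
        = c *: (x - f x *: v) + (y - f y *: v).
  by rewrite scalerDl scalerBr scalerA opprD addrACA.
exact: WL.
Qed.

End SeparatingFunctional.

Section TensorAlgebra.
Context (k : fieldType) (A B : algType k).

Definition tprod : Type := tensor (fun (a : A) (c : k) => c *: a) B.

HB.instance Definition _ := GRing.Zmodule.on tprod.

Definition otimes (a : A) (b : B) : tprod :=
  tpure (fun (a : A) (c : k) => c *: a) a b.

Lemma otimesDl a a' b : otimes (a + a') b = otimes a b + otimes a' b.
Proof. exact: tpureDl. Qed.

Lemma otimesDr a b b' : otimes a (b + b') = otimes a b + otimes a b'.
Proof. exact: tpureDr. Qed.

Lemma otimesZ c a b : otimes (c *: a) b = otimes a (c *: b).
Proof. exact: (tpureZ (fun (a : A) (c : k) => c *: a)). Qed.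

Lemma otimes_ind (P : tprod -> Prop) :
    P 0 -> (forall a b, P (otimes a b)) ->
    (forall u v, P u -> P v -> P (u + v)) -> forall u, P u.
Proof. exact: tpure_ind. Qed.

Definition tprod_lift (G : zmodType) (f : A -> B -> G) : tprod -> G := tlift f.

Definition kbalanced (G : zmodType) (f : A -> B -> G) : Prop :=
  balanced (fun (a : A) (c : k) => c *: a) f.

Lemma tprod_liftE (G : zmodType) (f : A -> B -> G) a b :
  kbalanced f -> tprod_lift f (otimes a b) = f a b.
Proof. by move=> fP; apply: tliftE. Qed.

Lemma tprod_liftD (G : zmodType) (f : A -> B -> G) :
  kbalanced f -> {morph tprod_lift f : u v / u + v}.
Proof. exact: tliftD. Qed.

Lemma tprod_lift0 (G : zmodType) (f : A -> B -> G) :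
  kbalanced f -> tprod_lift f 0 = 0.
Proof. exact: tlift0. Qed.

Definition tprod_scale (c : k) : tprod -> tprod :=
  tprod_lift (fun a b => otimes (c *: a) b).

Fact tprod_scale_balanced c : kbalanced (fun a b => otimes (c *: a) b).
Proof.
split=> [a a' b|a b b'|a d b]; first by rewrite scalerDr otimesDl.
  exact: otimesDr.
by rewrite scalerA mulrC -scalerA otimesZ.
Qed.

Fact tprod_scaleE c a b : tprod_scale c (otimes a b) = otimes (c *: a) b.
Proof. exact: (tprod_liftE _ _ (tprod_scale_balanced c)). Qed.

Fact tprod_scaleDr c : {morph tprod_scale c : u v / u + v}.
Proof. exact: (tprod_liftD (tprod_scale_balanced c)). Qed.

Fact tprod_scale0 c : tprod_scale c 0 = 0.
Proof. exact: (tprod_lift0 (tprod_scale_balanced c)). Qed.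

Fact tprod_scaleA c d u :
  tprod_scale c (tprod_scale d u) = tprod_scale (c * d) u.
Proof.
elim/otimes_ind: u => [|a b|u v IHu IHv]; first by rewrite !tprod_scale0.
  by rewrite !tprod_scaleE scalerA.
by rewrite !tprod_scaleDr IHu IHv.
Qed.

Fact tprod_scale1 : left_id 1 tprod_scale.
Proof.
elim/otimes_ind => [|a b|u v IHu IHv]; first by rewrite !tprod_scale0.
  by rewrite tprod_scaleE scale1r.
by rewrite tprod_scaleDr IHu IHv.
Qed.

Fact tprod_scaleDl u : {morph tprod_scale^~ u : c d / c + d}.
Proof.
move=> c d; elim/otimes_ind: u => [|a b|u v IHu IHv].
- by rewrite !tprod_scale0 addr0.
- by rewrite !tprod_scaleE scalerDl otimesDl.
- by rewrite !tprod_scaleDr IHu IHv addrACA.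
Qed.

HB.instance Definition _ := GRing.Zmodule_isLmodule.Build k tprod
  tprod_scaleA tprod_scale1 tprod_scaleDr tprod_scaleDl.

Lemma scale_otimesl (c : k) a b : c *: otimes a b = otimes (c *: a) b.
Proof. exact: tprod_scaleE. Qed.

Lemma scale_otimesr (c : k) a b : c *: otimes a b = otimes a (c *: b).
Proof. by rewrite scale_otimesl otimesZ. Qed.

Definition tprod_mul (u v : tprod) : tprod :=
  tprod_lift
    (fun a b => tprod_lift (fun a' b' => otimes (a * a') (b * b')) v) u.

Let mul1_balanced a b : kbalanced (fun a' b' => otimes (a * a') (b * b')).
Proof.
split=> [x x' y|x y y'|x d y]; rewrite ?mulrDr ?otimesDl ?otimesDr //.
by rewrite -!scalerAr otimesZ.
Qed.

Let mul_balanced v : kbalanced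
  (fun a b => tprod_lift (fun a' b' => otimes (a * a') (b * b')) v).
Proof.
split=> [x x' y|x y y'|x d y].
- elim/otimes_ind: v => [|a b|u v IHu IHv].
  + by rewrite !tprod_lift0 ?addr0.
  + by rewrite !tprod_liftE // mulrDl otimesDl.
  + by rewrite !tprod_liftD // IHu IHv addrACA.
- elim/otimes_ind: v => [|a b|u v IHu IHv].
  + by rewrite !tprod_lift0 ?addr0.
  + by rewrite !tprod_liftE // mulrDl otimesDr.
  + by rewrite !tprod_liftD // IHu IHv addrACA.
- elim/otimes_ind: v => [|a b|u v IHu IHv].
  + by rewrite !tprod_lift0.
  + by rewrite !tprod_liftE // -!scalerAl otimesZ.
  + by rewrite !tprod_liftD // IHu IHv.
Qed.

Let tmulE a b a' b' :
  tprod_mul (otimes a b) (otimes a' b') = otimes (a * a') (b * b').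
Proof. by rewrite /tprod_mul !tprod_liftE. Qed.

Let tmulDl : left_distributive tprod_mul +%R.
Proof. by move=> u v w; rewrite /tprod_mul tprod_liftD. Qed.

Let tmul0l v : tprod_mul 0 v = 0.
Proof. by rewrite /tprod_mul tprod_lift0. Qed.

Let tmul0r u : tprod_mul u 0 = 0.
Proof.
elim/otimes_ind: u => [|a b|u v IHu IHv]; first exact: tmul0l.
  by rewrite /tprod_mul tprod_liftE // tprod_lift0.
by rewrite tmulDl IHu IHv addr0.
Qed.

Let tmulDr : right_distributive tprod_mul +%R.
Proof.
move=> u v w; elim/otimes_ind: u => [|a b|u u' IHu IHu'].
- by rewrite !tmul0l addr0.
- by rewrite /tprod_mul !tprod_liftE // tprod_liftD.
- by rewrite !tmulDl IHu IHu' addrACA.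
Qed.

Let tmulA : associative tprod_mul.
Proof.
move=> u v w; elim/otimes_ind: u => [|a b|u u' IHu IHu'].
- by rewrite !tmul0l.
- elim/otimes_ind: v => [|a' b'|v v' IHv IHv'].
  + by rewrite tmul0l !tmul0r tmul0l.
  + elim/otimes_ind: w => [|a'' b''|w w' IHw IHw'].
    * by rewrite !tmul0r.
    * by rewrite !tmulE !mulrA.
    * by rewrite !tmulDr IHw IHw'.
  + by rewrite tmulDl !tmulDr !tmulDl IHv IHv'.
- by rewrite !tmulDl IHu IHu'.
Qed.

Let tmul1l : left_id (otimes 1 1) tprod_mul.
Proof.
elim/otimes_ind => [|a b|u v IHu IHv]; first exact: tmul0r.
  by rewrite tmulE !mul1r.
by rewrite tmulDr IHu IHv.
Qed.

Let tmul1r : right_id (otimes 1 1) tprod_mul.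
Proof.
elim/otimes_ind => [|a b|u v IHu IHv]; first exact: tmul0l.
  by rewrite tmulE !mulr1.
by rewrite tmulDl IHu IHv.
Qed.

Let one_neq0 : otimes 1 1 != 0.
Proof.
have [f [fL f1]] := separating_functional (oner_neq0 A).
have [g [gL g1]] := separating_functional (oner_neq0 B).
have lin0 (V : lmodType k) (h : V -> k) :
    (forall c x y, h (c *: x + y) = c * h x + h y) -> h 0 = 0.
  move=> hL; have := hL 1 0 0; rewrite scaler0 addr0 mul1r => h0.
  by apply: (addrI (h 0)); rewrite -h0 addr0.
pose h (a : A) (b : B) : k := f a * g b.
have hP : kbalanced h.
  split=> [x x' y|x y y'|x d y]; rewrite /h.
  - by rewrite -[x]scale1r fL mul1r scale1r mulrDl.
  - by rewrite -[y]scale1r gL mul1r scale1r mulrDr.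
  - by rewrite -[d *: x]addr0 -[d *: y]addr0 fL gL !lin0 // !addr0 mulrCA mulrA.
apply/eqP => /(congr1 (tprod_lift h)).
rewrite tprod_liftE // tprod_lift0 // /h f1 g1 mulr1; apply/eqP/oner_neq0.
Qed.

HB.instance Definition _ := GRing.Zmodule_isNzRing.Build tprod
  tmulA tmul1l tmul1r tmulDl tmulDr one_neq0.

Lemma otimesM a b a' b' :
  otimes a b * otimes a' b' = otimes (a * a') (b * b').
Proof. exact: tmulE. Qed.

Fact tprod_scaleAl (c : k) (u v : tprod) : c *: (u * v) = c *: u * v.
Proof.
elim/otimes_ind: u => [|a b|u u' IHu IHu'].
- by rewrite !(scaler0, mul0r).
- elim/otimes_ind: v => [|a' b'|v v' IHv IHv'].
  + by rewrite !mulr0 scaler0.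
  + by rewrite scale_otimesl !otimesM scale_otimesl scalerAl.
  + by rewrite !mulrDr scalerDr IHv IHv'.
- by rewrite scalerDr !mulrDl scalerDr IHu IHu'.
Qed.

HB.instance Definition _ :=
  GRing.Lmodule_isLalgebra.Build k tprod tprod_scaleAl.

Fact tprod_scaleAr (c : k) (u v : tprod) : c *: (u * v) = u * (c *: v).
Proof.
elim/otimes_ind: u => [|a b|u u' IHu IHu'].
- by rewrite !(scaler0, mul0r).
- elim/otimes_ind: v => [|a' b'|v v' IHv IHv'].
  + by rewrite scaler0 !mulr0 scaler0.
  + by rewrite scale_otimesl !otimesM scale_otimesl scalerAr.
  + by rewrite scalerDr !mulrDr scalerDr IHv IHv'.
- by rewrite !mulrDl scalerDr IHu IHu'.
Qed.

HB.instance Definition _ := GRing.Lalgebra_isAlgebra.Build k tprod tprod_scaleAr.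

End TensorAlgebra.

Notation "A '\ox' B" := (tprod A%type B%type) : type_scope.
Notation "a '\ox' b" := (otimes a b) : ring_scope.

Section TensorMaps.
Context (k : fieldType).

Lemma otimes_kbalanced (A B C D : algType k)
    (f : {lrmorphism A -> C}) (g : {lrmorphism B -> D}) :
  kbalanced (fun a b => f a \ox g b).
Proof.
split=> [x x' y|x y y'|x d y]; rewrite ?rmorphD ?otimesDl ?otimesDr //.
by rewrite !linearZ otimesZ.
Qed.

Definition tmap (A B C D : algType k) (f : A -> C) (g : B -> D) :
  A \ox B -> C \ox D := tprod_lift (fun a b => f a \ox g b).

Section MapMorphism.
Context (A B C D : algType k).
Context (f : {lrmorphism A -> C}) (g : {lrmorphism B -> D}).

Lemma tmapE a b : tmap f g (a \ox b) = f a \ox g b.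
Proof. exact/tprod_liftE/otimes_kbalanced. Qed.

Let tmapD : {morph tmap f g : u v / u + v}.
Proof. exact/tprod_liftD/otimes_kbalanced. Qed.

Let tmap0 : tmap f g 0 = 0.
Proof. exact/tprod_lift0/otimes_kbalanced. Qed.

Fact tmap_zmod_morphism : zmod_morphism (tmap f g).
Proof. exact/tlift_zmod_morphism/otimes_kbalanced. Qed.

HB.instance Definition _ :=
  GRing.isZmodMorphism.Build (A \ox B)%type (C \ox D)%type (tmap f g) tmap_zmod_morphism.

Fact tmap_monoid_morphism : monoid_morphism (tmap f g).
Proof.
split=> [|u v]; first by rewrite tmapE !rmorph1.
elim/otimes_ind: u => [|a b|u u' IHu IHu'].
- by rewrite !(tmap0, mul0r).
- elim/otimes_ind: v => [|a' b'|v v' IHv IHv'].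
  + by rewrite !(tmap0, mulr0).
  + by rewrite !(otimesM, tmapE) !rmorphM.
  + by rewrite mulrDr !tmapD mulrDr IHv IHv'.
- by rewrite mulrDl !tmapD mulrDl IHu IHu'.
Qed.

HB.instance Definition _ :=
  GRing.isMonoidMorphism.Build (A \ox B)%type (C \ox D)%type (tmap f g)
    tmap_monoid_morphism.

Fact tmap_scalable : scalable (tmap f g).
Proof.
move=> c; elim/otimes_ind => [|a b|u v IHu IHv].
- by rewrite scaler0 tmap0 scaler0.
- by rewrite scale_otimesl !tmapE linearZ scale_otimesl.
- by rewrite scalerDr !tmapD scalerDr IHu IHv.
Qed.

HB.instance Definition _ :=
  GRing.isScalable.Build k (A \ox B)%type (C \ox D)%type *:%R (tmap f g) tmap_scalable.

End MapMorphism.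

Definition tswap (A B : algType k) : A \ox B -> B \ox A :=
  tprod_lift (fun a b => b \ox a).

Definition tassoc (A B C : algType k) : A \ox (B \ox C) -> A \ox B \ox C :=
  tprod_lift (fun a => tprod_lift (fun b c => a \ox b \ox c)).

Section Swap.
Context (A B : algType k).

Let swap_balanced : kbalanced (fun (a : A) (b : B) => b \ox a).
Proof.
split=> [x x' y|x y y'|x d y]; [exact: otimesDr | exact: otimesDl |].
by rewrite otimesZ.
Qed.

Lemma tswapE (a : A) (b : B) : tswap (a \ox b) = b \ox a.
Proof. exact: tprod_liftE. Qed.

Let tswapD : {morph @tswap A B : u v / u + v}.
Proof. exact: tprod_liftD. Qed.

Let tswap0 : @tswap A B 0 = 0.
Proof. exact: tprod_lift0. Qed.

Fact tswap_zmod_morphism : zmod_morphism (@tswap A B).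
Proof. exact: tlift_zmod_morphism. Qed.

HB.instance Definition _ :=
  GRing.isZmodMorphism.Build (A \ox B)%type (B \ox A)%type (@tswap A B)
    tswap_zmod_morphism.

Fact tswap_monoid_morphism : monoid_morphism (@tswap A B).
Proof.
split=> [|u v]; first by rewrite tswapE.
elim/otimes_ind: u => [|a b|u u' IHu IHu'].
- by rewrite !(tswap0, mul0r).
- elim/otimes_ind: v => [|a' b'|v v' IHv IHv'].
  + by rewrite !(tswap0, mulr0).
  + by rewrite !(otimesM, tswapE).
  + by rewrite mulrDr !tswapD mulrDr IHv IHv'.
- by rewrite mulrDl !tswapD mulrDl IHu IHu'.
Qed.

HB.instance Definition _ :=
  GRing.isMonoidMorphism.Build (A \ox B)%type (B \ox A)%type (@tswap A B)
    tswap_monoid_morphism.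

Fact tswap_scalable : scalable (@tswap A B).
Proof.
move=> c; elim/otimes_ind => [|a b|u v IHu IHv].
- by rewrite scaler0 tswap0 scaler0.
- by rewrite scale_otimesl !tswapE scale_otimesr.
- by rewrite scalerDr !tswapD scalerDr IHu IHv.
Qed.

HB.instance Definition _ :=
  GRing.isScalable.Build k (A \ox B)%type (B \ox A)%type *:%R (@tswap A B)
    tswap_scalable.

End Swap.

Section Assoc.
Context (A B C : algType k).

Let in_balanced (x : A) : kbalanced (fun (b : B) (c : C) => x \ox b \ox c).
Proof.
split=> [y y' z|y z z'|y d z]; rewrite ?otimesDr ?otimesDl //.
by rewrite -scale_otimesr otimesZ.
Qed.

Let out_balanced :
  kbalanced (fun a => tprod_lift (fun (b : B) (c : C) => (a : A) \ox b \ox c)).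
Proof.
split=> [x x' y|x y y'|x d y]; last 1 first.
- elim/otimes_ind: y => [|b' c'|u v IHu IHv].
  + by rewrite scaler0 !tprod_lift0.
  + by rewrite scale_otimesl !tprod_liftE // otimesZ.
  + by rewrite scalerDr !tprod_liftD // IHu IHv.
- elim/otimes_ind: y => [|b' c'|u v IHu IHv].
  + by rewrite !tprod_lift0 // addr0.
  + by rewrite !tprod_liftE // !otimesDl.
  + by rewrite !tprod_liftD // IHu IHv addrACA.
- by rewrite tprod_liftD.
Qed.

Lemma tassocE (a : A) (b : B) (c : C) :
  tassoc (a \ox (b \ox c)) = a \ox b \ox c.
Proof. by rewrite /tassoc tprod_liftE ?tprod_liftE. Qed.

Let tassocD : {morph @tassoc A B C : u v / u + v}.
Proof. exact: tprod_liftD. Qed.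

Let tassoc0 : @tassoc A B C 0 = 0.
Proof. exact: tprod_lift0. Qed.

Let assoc_ind (P : A \ox (B \ox C) -> Prop) :
    P 0 -> (forall a b c, P (a \ox (b \ox c))) ->
    (forall u v, P u -> P v -> P (u + v)) -> forall u, P u.
Proof.
move=> P0 P1 PD; elim/otimes_ind => // a; elim/otimes_ind => // [|u v Pu Pv].
  by rewrite -[0](scale0r (0 : B \ox C)) -scale_otimesr scale0r.
by rewrite otimesDr; apply: PD.
Qed.

Fact tassoc_zmod_morphism : zmod_morphism (@tassoc A B C).
Proof. exact: tlift_zmod_morphism. Qed.

HB.instance Definition _ :=
  GRing.isZmodMorphism.Build (A \ox (B \ox C))%type (A \ox B \ox C)%type
    (@tassoc A B C) tassoc_zmod_morphism.

Fact tassoc_monoid_morphism : monoid_morphism (@tassoc A B C).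
Proof.
split=> [|u v]; first by rewrite tassocE.
elim/assoc_ind: u => [|a b c|u u' IHu IHu'].
- by rewrite !(tassoc0, mul0r).
- elim/assoc_ind: v => [|a' b' c'|v v' IHv IHv'].
  + by rewrite !(tassoc0, mulr0).
  + by rewrite !(otimesM, tassocE).
  + by rewrite mulrDr !tassocD mulrDr IHv IHv'.
- by rewrite mulrDl !tassocD mulrDl IHu IHu'.
Qed.

HB.instance Definition _ :=
  GRing.isMonoidMorphism.Build (A \ox (B \ox C))%type (A \ox B \ox C)%type
    (@tassoc A B C) tassoc_monoid_morphism.

Fact tassoc_scalable : scalable (@tassoc A B C).
Proof.
move=> c; elim/assoc_ind => [|a b d|u v IHu IHv].
- by rewrite scaler0 tassoc0 scaler0.
- by rewrite scale_otimesl !tassocE !scale_otimesl.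
- by rewrite scalerDr !tassocD scalerDr IHu IHv.
Qed.

HB.instance Definition _ :=
  GRing.isScalable.Build k (A \ox (B \ox C))%type (A \ox B \ox C)%type *:%R
    (@tassoc A B C) tassoc_scalable.

End Assoc.

End TensorMaps.

(** * Extension of scalars: the left [S]-module [S (x)_R A], where [S] is a
right [R]-module through [phi : R -> S] *)

Section ScalarExtension.
Context (R S : nzRingType) (phi : {rmorphism R -> S}) (A : lmodType R).

Definition sext : Type := tensor (fun (s : S) (r : R) => s * phi r) A.

HB.instance Definition _ := GRing.Zmodule.on sext.

Definition sexto (s : S) (x : A) : sext :=
  tpure (fun (s : S) (r : R) => s * phi r) s x.

Definition sext_lift (G : zmodType) (f : S -> A -> G) : sext -> G := tlift f.

Definition sbalanced (G : zmodType) (f : S -> A -> G) : Prop :=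
  balanced (fun (s : S) (r : R) => s * phi r) f.

Lemma sextoDl s s' x : sexto (s + s') x = sexto s x + sexto s' x.
Proof. exact: tpureDl. Qed.

Lemma sextoDr s x x' : sexto s (x + x') = sexto s x + sexto s x'.
Proof. exact: tpureDr. Qed.

Lemma sextoZ s r x : sexto (s * phi r) x = sexto s (r *: x).
Proof. exact: (tpureZ (fun (s : S) (r : R) => s * phi r)). Qed.

Lemma sexto_ind (P : sext -> Prop) :
    P 0 -> (forall s x, P (sexto s x)) ->
    (forall u v, P u -> P v -> P (u + v)) -> forall u, P u.
Proof. exact: tpure_ind. Qed.

Lemma sext_liftE (G : zmodType) (f : S -> A -> G) s x :
  sbalanced f -> sext_lift f (sexto s x) = f s x.
Proof. by move=> fP; apply: tliftE. Qed.

Lemma sext_liftD (G : zmodType) (f : S -> A -> G) :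
  sbalanced f -> {morph sext_lift f : u v / u + v}.
Proof. exact: tliftD. Qed.

Lemma sext_lift0 (G : zmodType) (f : S -> A -> G) :
  sbalanced f -> sext_lift f 0 = 0.
Proof. exact: tlift0. Qed.

Definition sext_scale (s : S) : sext -> sext :=
  sext_lift (fun s' x => sexto (s * s') x).

Fact sext_scale_balanced s : sbalanced (fun s' x => sexto (s * s') x).
Proof.
split=> [s1 s2 x|s1 x x'|s1 r x]; first by rewrite mulrDr sextoDl.
  exact: sextoDr.
by rewrite mulrA sextoZ.
Qed.

Fact sext_scaleE s s' x : sext_scale s (sexto s' x) = sexto (s * s') x.
Proof. exact: (sext_liftE _ _ (sext_scale_balanced s)). Qed.

Fact sext_scaleDr s : {morph sext_scale s : u v / u + v}.
Proof. exact: (sext_liftD (sext_scale_balanced s)). Qed.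

Fact sext_scale0 s : sext_scale s 0 = 0.
Proof. exact: (sext_lift0 (sext_scale_balanced s)). Qed.

Fact sext_scaleA s s' u : sext_scale s (sext_scale s' u) = sext_scale (s * s') u.
Proof.
elim/sexto_ind: u => [|a b|u v IHu IHv]; first by rewrite !sext_scale0.
  by rewrite !sext_scaleE mulrA.
by rewrite !sext_scaleDr IHu IHv.
Qed.

Fact sext_scale1 : left_id 1 sext_scale.
Proof.
elim/sexto_ind => [|a b|u v IHu IHv]; first by rewrite !sext_scale0.
  by rewrite sext_scaleE mul1r.
by rewrite sext_scaleDr IHu IHv.
Qed.

Fact sext_scaleDl u : {morph sext_scale^~ u : s s' / s + s'}.
Proof.
move=> c d; elim/sexto_ind: u => [|a b|u v IHu IHv].
- by rewrite !sext_scale0 addr0.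
- by rewrite !sext_scaleE mulrDl sextoDl.
- by rewrite !sext_scaleDr IHu IHv addrACA.
Qed.

HB.instance Definition _ := GRing.Zmodule_isLmodule.Build S sext
  sext_scaleA sext_scale1 sext_scaleDr sext_scaleDl.

Lemma scale_sexto (s s' : S) x : s *: sexto s' x = sexto (s * s') x.
Proof. exact: sext_scaleE. Qed.

End ScalarExtension.

Notation "s '\ox_[' phi ] x" := (sexto phi s x) : ring_scope.

(** [theta (x)_R id], for [theta] compatible with the right [R]-actions *)
Definition sext_map (R S S' : nzRingType) (phi : {rmorphism R -> S})
    (phi' : {rmorphism R -> S'}) (A : lmodType R) (theta : S -> S') :
  sext phi A -> sext phi' A := sext_lift (fun s x => theta s \ox_[phi'] x).

Section ScalarExtensionMap.
Context (R S S' : nzRingType) (phi : {rmorphism R -> S}).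
Context (phi' : {rmorphism R -> S'}) (A : lmodType R).
Context (theta : {rmorphism S -> S'}).
Context (thetaE : forall r, theta (phi r) = phi' r).

Let mapP : sbalanced phi (fun s (x : A) => theta s \ox_[phi'] x).
Proof.
split=> [s s' x|s x x'|s r x]; first by rewrite rmorphD sextoDl.
  exact: sextoDr.
by rewrite rmorphM thetaE sextoZ.
Qed.

Local Notation map := (@sext_map _ _ _ phi phi' A theta).

Lemma sext_mapE s (x : A) : map (s \ox_[phi] x) = theta s \ox_[phi'] x.
Proof. exact: sext_liftE. Qed.

Lemma sext_mapD : {morph map : u v / u + v}.
Proof. exact: sext_liftD. Qed.

Lemma sext_map0 : map 0 = 0.
Proof. exact: sext_lift0. Qed.

Lemma sext_mapZ s u : map (s *: u) = theta s *: map u.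
Proof.
elim/sexto_ind: u => [|s' x|u v IHu IHv].
- by rewrite scaler0 sext_map0 scaler0.
- by rewrite scale_sexto !sext_mapE scale_sexto rmorphM.
- by rewrite scalerDr !sext_mapD scalerDr IHu IHv.
Qed.

End ScalarExtensionMap.

(** * Lie algebras and enveloping algebras *)

Section Enveloping.
Context (k : fieldType).

Record lie_bracket (L : lmodType k) (br : L -> L -> L) : Prop := LieBracket {
  lie_linearl : forall c x y z, br (c *: x + y) z = c *: br x z + br y z;
  lie_linearr : forall c x y z, br x (c *: y + z) = c *: br x y + br x z;
  lie_alternating : forall x, br x x = 0;
  lie_jacobi : forall x y z, br x (br y z) + br y (br z x) + br z (br x y) = 0
}.

Definition lie_morphism (L : lmodType k) (br : L -> L -> L) (A : algType k)
    (f : L -> A) : Prop :=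
  forall x y, f (br x y) = f x * f y - f y * f x.

(** [(H, iota)] satisfies the universal property of the enveloping algebra *)
Definition enveloping_algebra (L : lmodType k) (br : L -> L -> L)
    (H : algType k) (iota : {linear L -> H}) : Prop :=
  lie_morphism br iota /\
  forall (A : algType k) (f : {linear L -> A}), lie_morphism br f ->
    exists g : {lrmorphism H -> A},
      (forall x, g (iota x) = f x) /\
      (forall g' : {lrmorphism H -> A},
         (forall x, g' (iota x) = f x) -> g' =1 g).

(** As [iota L] generates [H], this determines [Delta]. *)
Definition enveloping_coproduct (L : lmodType k) (H : algType k)
    (iota : {linear L -> H}) (Delta : {lrmorphism H -> H \ox H}) : Prop :=
  forall x, Delta (iota x) = iota x \ox 1 + 1 \ox iota x.

Lemma enveloping_ext (L : lmodType k) (br : L -> L -> L) (H : algType k)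
    (iota : {linear L -> H}) (B : algType k) (f g : {lrmorphism H -> B}) :
  enveloping_algebra br iota -> (forall x, f (iota x) = g (iota x)) -> f =1 g.
Proof.
move=> [iotaL H_univ] fg.
have gL : lie_morphism br (g \o iota).
  by move=> x y; rewrite /= iotaL rmorphB !rmorphM.
have [h [_ hU]] := H_univ B (g \o iota) gL.
by move=> x; rewrite (hU f) // (hU g).
Qed.

End Enveloping.

(** * Pseudoalgebras *)

Section Pseudoalgebra.
Context (k : fieldType) (H : algType k) (Delta : {lrmorphism H -> H \ox H}).
Context (A : lmodType H).

Definition Delta2 : {lrmorphism H -> H \ox H \ox H} := tmap Delta idfun \o Delta.

Local Notation A2 := (sext Delta A).
Local Notation A3 := (sext Delta2 A).

Context (ast : A -> A -> A2).

(** [k]-bilinearity is a special case of [H]-bilinearity. *)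
Record pseudoproduct : Prop := Pseudoproduct {
  pseudoDl : forall x x' y, ast (x + x') y = ast x y + ast x' y;
  pseudoDr : forall x y y', ast x (y + y') = ast x y + ast x y';
  pseudoZ : forall h g x y, ast (h *: x) (g *: y) = (h \ox g) *: ast x y
}.

(** [(beta (x)_H x) * y], extended linearly in its first argument *)
Definition ast_l (u : A2) (y : A) : A3 :=
  sext_lift (fun beta x =>
    (beta \ox 1) *: sext_map Delta2 (tmap Delta idfun) (ast x y)) u.

(** [x * (beta (x)_H y)], extended linearly in its second argument *)
Definition ast_r (x : A) (v : A2) : A3 :=
  sext_lift (fun beta y =>
    tassoc (1 \ox beta) *:
      sext_map Delta2 (fun alpha => tassoc (tmap idfun Delta alpha)) (ast x y))
    v.

Definition perm12 : A3 -> A3 := sext_map Delta2 (tmap (@tswap k H H) idfun).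

Definition left_pre_lie : Prop := forall x y z : A,
  ast_l (ast x y) z - ast_r x (ast y z) =
  perm12 (ast_l (ast y x) z - ast_r y (ast x z)).

End Pseudoalgebra.

(** The three liftings above are well defined on enveloping algebras. *)

Section PseudoalgebraTheory.
Context (k : fieldType) (L : lmodType k) (br : L -> L -> L) (H : algType k).
Context (iota : {linear L -> H}) (H_env : enveloping_algebra br iota).
Context (Delta : {lrmorphism H -> H \ox H}).
Context (Delta_cop : enveloping_coproduct iota Delta).
Context (A : lmodType H) (ast : A -> A -> sext Delta A).
Context (ast_pseudo : pseudoproduct ast).

Lemma enveloping_coassoc h :
  tassoc (tmap idfun Delta (Delta h)) = Delta2 Delta h.
Proof.
move: h; apply: (enveloping_ext
  (f := @tassoc k H H H \o (tmap idfun Delta \o Delta)) H_env) => x /=.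
rewrite Delta_cop !rmorphD /= !tmapE /= rmorph1 Delta_cop.
by rewrite !otimesDr otimesDl !rmorphD /= !tassocE addrA.
Qed.

Lemma enveloping_cocomm h : tswap (Delta h) = Delta h.
Proof.
move: h; apply: (enveloping_ext (f := @tswap k H H \o Delta) H_env) => x /=.
by rewrite Delta_cop rmorphD /= !tswapE addrC.
Qed.

Lemma ast_lE beta (x y : A) :
  ast_l ast (beta \ox_[Delta] x) y =
  (beta \ox 1) *: sext_map (Delta2 Delta) (tmap Delta idfun) (ast x y).
Proof.
apply: sext_liftE; split=> [b b' z|b z z'|b r z].
- by rewrite otimesDl scalerDl.
- by rewrite (pseudoDl ast_pseudo) sext_mapD // scalerDr.
- rewrite -[y in RHS]scale1r (pseudoZ ast_pseudo) sext_mapZ // scalerA.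
  by rewrite /= tmapE /= otimesM mulr1.
Qed.

Lemma ast_rE (x : A) beta (y : A) :
  ast_r ast x (beta \ox_[Delta] y) =
  tassoc (1 \ox beta) *: sext_map (Delta2 Delta)
    (fun alpha => tassoc (tmap idfun Delta alpha)) (ast x y).
Proof.
pose theta : {rmorphism H \ox H -> H \ox H \ox H} :=
  @tassoc k H H H \o tmap idfun Delta.
have thetaE h : theta (Delta h) = Delta2 Delta h by apply: enveloping_coassoc.
apply: (@sext_liftE _ _ Delta A _ (fun beta z =>
  tassoc (1 \ox beta) *: sext_map (Delta2 Delta) theta (ast x z))).
split=> [b b' z|b z z'|b r z].
- by rewrite otimesDr rmorphD scalerDl.
- by rewrite (pseudoDr ast_pseudo) (sext_mapD thetaE) scalerDr.
- rewrite -[x in RHS]scale1r (pseudoZ ast_pseudo).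
  rewrite (sext_mapZ thetaE) scalerA /= tmapE /= -rmorphM /=.
  by rewrite otimesM mulr1.
Qed.

Lemma perm12E gamma (x : A) :
  perm12 (gamma \ox_[Delta2 Delta] x) =
  tmap (@tswap k H H) idfun gamma \ox_[Delta2 Delta] x.
Proof.
apply: sext_mapE => h; rewrite /Delta2 /=.
elim/otimes_ind: (Delta h) => [|a b|u v IHu IHv]; first by rewrite !rmorph0.
  by rewrite !tmapE /= enveloping_cocomm.
by rewrite !rmorphD /= IHu IHv.
Qed.

End PseudoalgebraTheory.

Definition basis2 (H : nzRingType) (P : lmodType H) (e1 e2 : P) : Prop :=
  bijective (fun ab : H * H => ab.1 *: e1 + ab.2 *: e2).

(* Main.v *)
Require Import Defs.
From HB Require Import structures.
From mathcomp Require Import all_boot all_order all_algebra.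
From mathcomp Require Import boolp ring.

(** Write [e1 * e2 = a (x) e1 + b (x) e2] and [e2 * e1 = c (x) e1 + d (x) e2]
with [a], [b], [c], [d] in [H (x) H].  The associator is trilinear over [H], and
the extended modules are free on [e1], [e2], so the left pre-Lie identity is a
system of equations in [H (x) H (x) H] between [a], [b], [c], [d]
([left_pre_lie_coef]).  If all four are scalars, these are the equations of an
ordinary two-dimensional pre-Lie algebra over the field, which the eight types
satisfy ([left_pre_lie_of_table]).  The point of the theorem is that nothing
else occurs, and for that it has to be shown that [a], [b], [c], [d] are scalars.

Think of [H] as polynomials, so that [Delta h] becomes [h(x + y)].  The identity
at [(e1, e1, e2)] says that [b(y, z) b(x, y + z)] is symmetric in [x] and [y].
On one side the degree in [x] is [deg_1 b], on the other it is
[deg_1 b + deg_2 b]; so [b] does not depend on its second variable, and neither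
does [c] ([symmetric_nested_square]).  The identity at [(e1, e2, e1)] then makes
[d(y, z) a(x, y + z)] independent of [z], so that [a = 0], or [d = 0], or
neither depends on its second variable ([nested_product_const]).  In each of the
three cases, applying the counit to some of the variables leaves equations in
[H] itself, and comparing degrees there forces all unknowns to be scalars
([corner_classification], [interior_classification]).

To use this in a noncommutative [H] one needs degrees which add up under
multiplication.  They come from the coproduct.  A functional [phi] with
[phi 1 = 0] acts on [H] by [h |-> phi(h_2) h_1], and this operator lowers
degrees; [h] has degree at most [n] when every [n + 1] such operators kill it
([filt]).  To leading order the operators are derivations ([hit_mul_rule]),
hence the scalar [phi^n(h)], the value at [phi] of the symbol of [h], is
multiplicative up to a binomial coefficient ([iter_hit_mul]).  In characteristic
zero the symbol of an element of degree [n] is not the zero function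
([filt_polarization]), and two nonzero symbols have a common nonzero point, so
degrees add up ([filt_mul_neq]).  Every element has a degree, since [H] is
generated by primitive elements ([filt_exhaustive]). *)

Set Implicit Arguments.
Unset Strict Implicit.
Unset Printing Implicit Defensive.

Import GRing.Theory.
Local Open Scope ring_scope.

(** * Linear functionals and slices of tensors *)

Lemma char0_nonroot (k : fieldType) (p : {poly k}) : [pchar k] =i pred0 ->
  p != 0 -> exists x, ~~ root p x.
Proof.
move=> k0 p0; apply: contrapT => all_root.
have := max_poly_roots (rs := [seq i%:R | i <- iota 0 (size p)]) p0.
rewrite size_map size_iota ltnn => max; suff: false by []; apply: max.
  by apply/allP => x _; apply: contraT => nx; case: all_root; exists x.
rewrite map_inj_uniq ?iota_uniq // => i j /eqP.
wlog le_ij : i j / (i <= j)%N => [IH|].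
  by have [/IH|/ltnW/IH] := leqP i j; rewrite 1?eq_sym // => H /H.
rewrite eq_sym -subr_eq0 -natrB // ((pcharf0P k).1 k0) subn_eq0 => le_ji.
by apply/eqP; rewrite eqn_leq le_ij.
Qed.

Section ScalarFunctionals.
Context (k : fieldType) (V : lmodType k).
Implicit Types (f : V -> k) (v : V).

Lemma scalarf0 f : scalar f -> f 0 = 0.
Proof.
by move=> fL; have := fL (-1) 0 0; rewrite scaler0 addr0 mulN1r addNr.
Qed.

Lemma scalarfD f : scalar f -> {morph f : x y / x + y}.
Proof. by move=> fL x y; have := fL 1 x y; rewrite scale1r mul1r. Qed.

Lemma scalarfZ f : scalar f -> forall c x, f (c *: x) = c * f x.
Proof. by move=> fL c x; rewrite -[c *: x]addr0 fL scalarf0 // addr0. Qed.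

Lemma scalarf_sum f n (F : 'I_n -> V) : scalar f ->
  f (\sum_(i < n) F i) = \sum_(i < n) f (F i).
Proof. by move=> fL; apply: (big_morph f (scalarfD fL) (scalarf0 fL)). Qed.

Lemma scalar_comb f g (c : k) : scalar f -> scalar g ->
  scalar (fun v => f v + c * g v).
Proof. by move=> fL gL d x y; rewrite fL gL !mulrDr mulrCA addrACA. Qed.

Lemma separating_scalar v : v != 0 -> exists2 f : V -> k, scalar f & f v = 1.
Proof. by move=> /separating_functional [f [fL fv]]; exists f. Qed.

(** The vectors are treated one at a time: what a new vector adds to the span of
the previous ones is detected by a functional that vanishes on that span. *)
Lemma finite_dual_basis (s : seq V) :
  exists n (e : nat -> V) (phi : nat -> V -> k),
    (forall i, scalar (phi i)) /\
    {in s, forall v, v = \sum_(i < n) phi i v *: e i}.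
Proof.
elim: s => [|a s [n [e [phi [phiL phiE]]]]].
  by exists 0%N, (fun=> 0), (fun _ _ => 0); split=> // i c x y; rewrite mulr0 addr0.
pose rem v := v - \sum_(i < n) phi i v *: e i.
have remL c x y : rem (c *: x + y) = c *: rem x + rem y.
  rewrite /rem scalerBr addrACA; congr (_ + _).
  rewrite scaler_sumr -opprD -big_split /=; congr (- _); apply: eq_bigr => i _.
  by rewrite phiL scalerDl scalerA.
have rems v : v \in s -> rem v = 0.
  by move=> /phiE sv; rewrite /rem -sv subrr.
have [a0|a0] := eqVneq (rem a) 0.
  exists n, e, phi; split=> // v; rewrite inE => /predU1P[->|/phiE //].
  by apply/eqP; rewrite -subr_eq0; apply/eqP.
have [f fL fa] := separating_scalar a0.
exists n.+1, (fun i => if i is j.+1 then e j else rem a),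
  (fun i => if i is j.+1 then phi j else f \o rem).
split=> [[|i]|v]; [by move=> c x y; rewrite /= remL fL | exact: phiL |].
rewrite big_ord_recl /= inE => /predU1P[->|sv].
  by rewrite fa scale1r /rem subrK.
by rewrite rems // scalarf0 // scale0r add0r; apply: phiE.
Qed.

End ScalarFunctionals.

Section Contraction.
Context (k : fieldType) (A B : algType k).
Implicit Types (phi chi : B -> k) (u v : A \ox B).

(** The slice map [id (x) phi]. *)
Definition contr phi u : A := tprod_lift (fun a b => phi b *: a) u.

Section OneFunctional.
Context (phi : B -> k) (phiL : scalar phi).

Let contr_balanced : kbalanced (fun (a : A) b => phi b *: a).
Proof.
split=> [a a' b|a b b'|a c b]; first by rewrite scalerDr.
  by rewrite scalarfD // scalerDl.
by rewrite scalerA (scalarfZ phiL) mulrC.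
Qed.

Lemma contrE a b : contr phi (a \ox b) = phi b *: a.
Proof. exact: tprod_liftE. Qed.

Lemma contr0 : contr phi 0 = 0.
Proof. exact: tprod_lift0. Qed.

Lemma contrD : {morph contr phi : u v / u + v}.
Proof. exact: tprod_liftD. Qed.

Lemma contrZ c u : contr phi (c *: u) = c *: contr phi u.
Proof.
elim/otimes_ind: u => [|a b|u v IHu IHv]; first by rewrite scaler0 contr0 scaler0.
  by rewrite scale_otimesl !contrE !scalerA mulrC.
by rewrite scalerDr !contrD scalerDr IHu IHv.
Qed.

Lemma contr_sum n (F : 'I_n -> A \ox B) :
  contr phi (\sum_(i < n) F i) = \sum_(i < n) contr phi (F i).
Proof. exact: (big_morph _ contrD contr0). Qed.

Lemma contrB u v : contr phi (u - v) = contr phi u - contr phi v.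
Proof. by rewrite contrD -scaleN1r contrZ scaleN1r. Qed.

End OneFunctional.

Lemma contr_comb phi chi c u : scalar phi -> scalar chi ->
  contr (fun b => phi b + c * chi b) u = contr phi u + c *: contr chi u.
Proof.
move=> phiL chiL; have L := scalar_comb c phiL chiL.
elim/otimes_ind: u => [|a b|u v IHu IHv].
- by rewrite !contr0 // scaler0 addr0.
- by rewrite !contrE // scalerDl scalerA.
- by rewrite !contrD // IHu IHv scalerDr addrACA.
Qed.

Lemma otimes0l (b : B) : (0 : A) \ox b = 0.
Proof. exact: tpure0l. Qed.

Lemma otimes0r (a : A) : a \ox (0 : B) = 0.
Proof. by rewrite -[0](scale0r (0 : B)) -otimesZ scale0r otimes0l. Qed.

Lemma otimesBl (a a' : A) (b : B) : (a - a') \ox b = a \ox b - a' \ox b.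
Proof. by rewrite otimesDl /otimes tpureNl. Qed.

(** The right factors of [u] and the extra vector [b0] are resolved by one family
of functionals.  With [b0 = 1] this makes it possible to split off from each
functional its value at the unit. *)
Lemma contr_expand u (b0 : B) :
  exists n (e : nat -> B) (phi : nat -> B -> k),
    [/\ forall i, scalar (phi i), u = \sum_(i < n) contr (phi i) u \ox e i
      & b0 = \sum_(i < n) phi i b0 *: e i].
Proof.
have [s uE] : exists s : seq (A * B), u = \sum_(p <- s) p.1 \ox p.2.
  elim/otimes_ind: u => [|a b|u v [s ->] [t ->]].
  - by exists [::]; rewrite big_nil.
  - by exists [:: (a, b)]; rewrite big_seq1.
  - by exists (s ++ t); rewrite big_cat.
have [n [e [phi [phiL phiE]]]] := finite_dual_basis (b0 :: map snd s).
exists n, e, phi; split=> //; last by apply: phiE; rewrite mem_head.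
rewrite {1}uE.
have sub p : p \in s -> p.2 \in b0 :: map snd s.
  by move=> sp; rewrite inE map_f ?orbT.
have contrs i : contr (phi i) u = \sum_(p <- s) phi i p.2 *: p.1.
  rewrite uE (big_morph _ (contrD (phiL i)) (contr0 (phiL i))).
  by apply: eq_bigr => p _; rewrite contrE.
under [RHS]eq_bigr do rewrite contrs.
transitivity (\sum_(p <- s) \sum_(i < n) (phi i p.2 *: p.1) \ox e i).
  apply: eq_big_seq => p /sub /phiE {1}->.
  rewrite (big_morph (fun b => p.1 \ox b) (otimesDr p.1) (otimes0r p.1)).
  by apply: eq_bigr => i _; rewrite otimesZ.
rewrite exchange_big; apply: eq_bigr => i _.
by rewrite (big_morph (fun a => a \ox e i) (fun a a' => otimesDl a a' (e i))
  (otimes0l (e i))).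
Qed.

Lemma contr_inj u : (forall phi, scalar phi -> contr phi u = 0) -> u = 0.
Proof.
move=> u0; have [n [e [phi [phiL -> _]]]] := contr_expand u 0.
by rewrite big1 // => i _; rewrite u0 // otimes0l.
Qed.

End Contraction.

(** * Generation by the Lie algebra, and the counit *)

(** A subalgebra [S] containing the image of the Lie algebra is all of [H]: by the
universal property the inclusion of [S] has a section which is the identity on
generators, hence everywhere. *)
Section GeneratedSubalgebra.
Context (k : fieldType) (H : algType k) (S : H -> Prop).
Context (S1 : S 1) (SL : forall c x y, S x -> S y -> S (c *: x + y)).
Context (SM : forall x y, S x -> S y -> S (x * y)).

Definition subalgb : {pred H} := fun h => `[< S h >].

Fact subalgb_closed : subalg_closed subalgb.
Proof.
split=> [|c x y /asboolP Sx /asboolP Sy|x y /asboolP Sx /asboolP Sy];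
  by apply/asboolP; auto.
Qed.

HB.instance Definition _ :=
  GRing.isSubalgClosed.Build k H subalgb subalgb_closed.

Record subalg := Subalg { subalg_val :> H; _ : subalg_val \in subalgb }.
HB.instance Definition _ := [isSub for subalg_val].
HB.instance Definition _ := [Choice of subalg by <:].
HB.instance Definition _ := [SubChoice_isSubAlgebra of subalg by <:].

Let inc (h : subalg) : H := \val h.

Let inc_linear : linear inc.
Proof. by move=> c x y; rewrite /inc linearP. Qed.

Let inc_monoid_morphism : monoid_morphism inc.
Proof. by split=> [|x y]; rewrite /inc ?rmorph1 ?rmorphM. Qed.

HB.instance Definition _ := GRing.isLinear.Build k subalg H *:%R inc inc_linear.
HB.instance Definition _ :=
  GRing.isMonoidMorphism.Build subalg H inc inc_monoid_morphism.

Context (L : lmodType k) (br : L -> L -> L) (iota : {linear L -> H}).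
Context (H_env : enveloping_algebra br iota) (Siota : forall x, S (iota x)).

Let f (x : L) : subalg := Subalg (introT (asboolP _) (Siota x)).

Let f_linear : linear f.
Proof. by move=> c x y; apply: val_inj; rewrite linearP /= linearP. Qed.

HB.instance Definition _ := GRing.isLinear.Build k L subalg *:%R f f_linear.

Lemma enveloping_ind h : S h.
Proof.
have [iotaL H_univ] := H_env.
have fL : lie_morphism br f.
  by move=> x y; apply: val_inj; rewrite rmorphB !rmorphM /= iotaL.
have [g [gE _]] := H_univ subalg f fL.
pose r : {lrmorphism H -> H} := inc \o g.
have rK : r =1 (idfun : {lrmorphism H -> H}).
  by apply: (enveloping_ext H_env) => x; rewrite /= gE.
by rewrite -[h]/(idfun h) -[idfun h]rK /=; apply/asboolP; case: (g h).
Qed.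

End GeneratedSubalgebra.

(** The counit extends the zero map of the Lie algebra. *)
Lemma enveloping_counit (k : fieldType) (L : lmodType k) (br : L -> L -> L)
    (H : algType k) (iota : {linear L -> H}) :
  enveloping_algebra br iota ->
  exists eps : H -> k, [/\ scalar eps, eps 1 = 1, {morph eps : x y / x * y}
    & forall x, eps (iota x) = 0].
Proof.
move=> [_ H_univ].
have [|eps [epsE _]] := H_univ k^o (GRing.null_fun k^o : {linear L -> k^o}).
  by move=> x y /=; rewrite mulr0 subrr.
exists eps; split=> //; [exact: linearP | exact: rmorph1 | exact: rmorphM].
Qed.

(** * Slices and the coproduct *)

Section TensorContraction.
Context (k : fieldType) (H : algType k).
Implicit Types (phi chi : H -> k) (u v : H \ox H).

Lemma contr_mulr chi u (a b : H) : scalar chi ->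
  contr chi (u * (a \ox b)) = contr (fun c => chi (c * b)) u * a.
Proof.
move=> chiL; have L : scalar (fun c => chi (c * b)).
  by move=> c x y; rewrite mulrDl -scalerAl chiL.
elim/otimes_ind: u => [|x y|u v IHu IHv].
- by rewrite mul0r !contr0 // mul0r.
- by rewrite otimesM !contrE // scalerAl.
- by rewrite mulrDl !contrD // IHu IHv mulrDl.
Qed.

Lemma contr_tassoc (chi : H -> k) (a : H) (z : H \ox H) : scalar chi ->
  contr chi (tassoc (a \ox z)) = a \ox contr chi z.
Proof.
move=> chiL; elim/otimes_ind: z => [|b c|u v IHu IHv].
- by rewrite otimes0r raddf0 !contr0 // otimes0r.
- by rewrite tassocE !contrE // scale_otimesr.
- by rewrite otimesDr raddfD /= !contrD // IHu IHv otimesDr.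
Qed.

Lemma contr_tswap phi chi u : scalar phi -> scalar chi ->
  phi (contr chi u) = chi (contr phi (tswap u)).
Proof.
move=> phiL chiL; elim/otimes_ind: u => [|a b|u v IHu IHv].
- by rewrite raddf0 !contr0 // !scalarf0.
- by rewrite tswapE !contrE // !scalarfZ // mulrC.
- by rewrite raddfD /= !contrD // !scalarfD // IHu IHv.
Qed.

Lemma tswapK u : tswap (tswap u) = u.
Proof.
elim/otimes_ind: u => [|a b|u v IHu IHv]; first by rewrite !raddf0.
  by rewrite !tswapE.
by rewrite !raddfD /= IHu IHv.
Qed.

End TensorContraction.

Section Coalgebra.
Context (k : fieldType) (delta : lmodType k) (br : delta -> delta -> delta).
Context (H : algType k).
Context (iota : {linear delta -> H}) (H_env : enveloping_algebra br iota).
Context (Delta : {lrmorphism H -> H \ox H}).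
Context (Delta_cop : enveloping_coproduct iota Delta).
Context (eps : H -> k) (epsL : scalar eps) (eps1 : eps 1 = 1).
Context (epsM : {morph eps : x y / x * y}) (eps_iota : forall x, eps (iota x) = 0).
Implicit Types (phi chi psi : H -> k) (u v : H \ox H) (h g : H).

Let cocomm h : tswap (Delta h) = Delta h.
Proof. exact: (enveloping_cocomm H_env Delta_cop). Qed.

Lemma contr_epsM u v : contr eps (u * v) = contr eps u * contr eps v.
Proof.
elim/otimes_ind: u => [|a b|u u' IHu IHu'].
- by rewrite mul0r contr0 // mul0r.
- elim/otimes_ind: v => [|a' b'|v v' IHv IHv'].
  + by rewrite mulr0 contr0 // mulr0.
  + by rewrite otimesM !contrE // epsM -scalerAl -scalerAr scalerA.
  + by rewrite mulrDr !contrD // mulrDr IHv IHv'.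
- by rewrite mulrDl !contrD // mulrDl IHu IHu'.
Qed.

Lemma counit h : contr eps (Delta h) = h.
Proof.
apply: (enveloping_ind (S := fun h => contr eps (Delta h) = h) _ _ _ H_env).
- by rewrite rmorph1 contrE // eps1 scale1r.
- by move=> c x y xE yE; rewrite linearP contrD // contrZ // xE yE.
- by move=> x y xE yE; rewrite rmorphM contr_epsM xE yE.
- by move=> x; rewrite Delta_cop contrD // !contrE // eps1 eps_iota scale1r scale0r addr0.
Qed.

(** The action of the convolution algebra of functionals on [H]. *)
Definition hit phi h : H := contr phi (Delta h).

(** The augmentation ideal of the convolution algebra. *)
Definition augmented phi : Prop := scalar phi /\ phi 1 = 0.

Lemma hitD phi h g : scalar phi -> hit phi (h + g) = hit phi h + hit phi g.
Proof. by move=> phiL; rewrite /hit raddfD contrD. Qed.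

Lemma hitZ phi c h : scalar phi -> hit phi (c *: h) = c *: hit phi h.
Proof. by move=> phiL; rewrite /hit linearZ contrZ. Qed.

Lemma hit0 phi : scalar phi -> hit phi 0 = 0.
Proof. by move=> phiL; rewrite /hit raddf0 contr0. Qed.

Lemma hit1 phi : scalar phi -> hit phi 1 = phi 1 *: 1.
Proof. by move=> phiL; rewrite /hit rmorph1 contrE. Qed.

Lemma hit_comb phi psi c h : scalar phi -> scalar psi ->
  hit (fun x => phi x + c * psi x) h = hit phi h + c *: hit psi h.
Proof. exact: contr_comb. Qed.

Lemma scalar_hit phi chi : scalar phi -> scalar chi ->
  scalar (fun h => phi (hit chi h)).
Proof. by move=> phiL chiL c x y; rewrite hitD // hitZ // phiL. Qed.

Lemma eps_hit phi h : scalar phi -> eps (hit phi h) = phi h.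
Proof. by move=> phiL; rewrite /hit contr_tswap // cocomm counit. Qed.

Lemma Delta_contr chi u : scalar chi ->
  Delta (contr chi u) = contr chi (tmap Delta idfun u).
Proof.
move=> chiL; elim/otimes_ind: u => [|a b|u v IHu IHv].
- by rewrite !raddf0 !contr0 // raddf0.
- by rewrite tmapE /= !contrE // linearZ.
- by rewrite !raddfD /= !contrD // raddfD /= IHu IHv.
Qed.

Lemma contr_tmap_tassoc phi chi u : scalar phi -> scalar chi ->
  contr phi (contr chi (tassoc (tmap idfun Delta u))) =
  contr (fun h => phi (hit chi h)) u.
Proof.
move=> phiL chiL; have L := scalar_hit phiL chiL.
elim/otimes_ind: u => [|a b|u v IHu IHv].
- by rewrite !raddf0 !contr0.
- by rewrite tmapE /= contr_tassoc // !contrE.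
- by rewrite !raddfD /= !contrD // IHu IHv.
Qed.

(** Coassociativity: the operators [hit] compose by convolution. *)
Lemma hit_hit phi chi h : scalar phi -> scalar chi ->
  hit phi (hit chi h) = hit (fun x => phi (hit chi x)) h.
Proof.
move=> phiL chiL.
rewrite {1 2}/hit Delta_contr // -[tmap _ _ _](enveloping_coassoc H_env Delta_cop).
exact: contr_tmap_tassoc.
Qed.

Lemma hitC phi chi h : scalar phi -> scalar chi ->
  hit phi (hit chi h) = hit chi (hit phi h).
Proof.
move=> phiL chiL; rewrite !hit_hit //; congr (hit _ h); apply/funext => x.
by rewrite /hit contr_tswap // cocomm.
Qed.

(** Expanding [Delta g] as the sum of [hit (phi i) g (x) e i] and splitting
[phi i] into [phi i 1] times the counit and an augmented functional, one sees
that [Delta g] acts like [g (x) 1], up to terms in which [g] has been hit by an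
augmented functional. *)
Lemma contr_mul_Delta g :
  exists n (e : nat -> H) (omega : nat -> H -> k),
    (forall i, augmented (omega i)) /\
    forall u chi, scalar chi ->
      contr chi (u * Delta g) = contr chi u * g
        + \sum_(i < n) contr (fun b => chi (b * e i)) u * hit (omega i) g.
Proof.
have [n [e [phi [phiL gE oneE]]]] := contr_expand (Delta g) 1.
pose omega i := fun h => phi i h + (- phi i 1) * eps h.
have omegaE i : hit (phi i) g = phi i 1 *: g + hit (omega i) g.
  rewrite hit_comb // [hit eps g]counit scaleNr addrCA subrr addr0 //.
exists n, e, omega; split=> [i|u chi chiL].
  by split; [apply: scalar_comb | rewrite /omega eps1 mulr1 subrr].
have L i : scalar (fun b => chi (b * e i)).
  by move=> c x y; rewrite mulrDl -scalerAl chiL.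
rewrite {1}gE mulr_sumr contr_sum //.
transitivity (\sum_(i < n) (contr (fun b => chi (b * e i)) u *
                (phi i 1 *: g) + contr (fun b => chi (b * e i)) u * hit (omega i) g)).
  by apply: eq_bigr => i _; rewrite contr_mulr // -mulrDr -omegaE.
rewrite big_split /=; congr (_ + _).
elim/otimes_ind: u => [|a b|u v IHu IHv].
- by rewrite contr0 // mul0r big1 // => i _; rewrite contr0 // mul0r.
- have chib : chi b = \sum_(i < n) phi i 1 * chi (b * e i).
    rewrite -[b in LHS]mulr1 [in LHS]oneE mulr_sumr scalarf_sum //.
    by apply: eq_bigr => i _; rewrite -scalerAr scalarfZ.
  rewrite contrE // chib scaler_suml mulr_suml; apply: eq_bigr => i _.
  by rewrite contrE // -scalerAr -!scalerAl scalerA.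
- rewrite contrD // mulrDl -IHu -IHv -big_split; apply: eq_bigr => i _.
  by rewrite contrD // mulrDl.
Qed.

(** An augmented functional acts as a derivation up to terms in which both factors
have been hit, and so have both lost a degree. *)
Lemma hit_mul_rule phi h g : augmented phi ->
  exists n (psi omega : nat -> H -> k),
    [/\ forall i, augmented (psi i), forall i, augmented (omega i)
      & hit phi (h * g) = h * hit phi g + hit phi h * g
          + \sum_(i < n) hit (psi i) h * hit (omega i) g].
Proof.
move=> [phiL phi1].
have [n [e [omega [omegaP gE]]]] := contr_mul_Delta g.
have L i : scalar (fun b => phi (b * e i)).
  by move=> c x y; rewrite mulrDl -scalerAl phiL.
pose psi i := fun b => phi (b * e i) + (- phi (e i)) * eps b.
have hit_psi i : hit (fun b => phi (b * e i)) h = phi (e i) *: h + hit (psi i) h.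
  by rewrite hit_comb // [hit eps h]counit scaleNr addrCA subrr addr0.
exists n, psi, omega; split=> // [i|].
  split; first exact: scalar_comb (L i) epsL.
  by rewrite /psi eps1 mulr1 mul1r subrr.
have hit_g : hit phi g = \sum_(i < n) phi (e i) *: hit (omega i) g.
  rewrite /hit -[Delta g]mul1r gE // contrE // phi1 scale0r mul0r add0r.
  by apply: eq_bigr => i _; rewrite contrE // !mul1r -scalerAl mul1r.
rewrite {1}/hit rmorphM gE // [h * _ + _]addrC -addrA; congr (_ + _).
rewrite hit_g mulr_sumr -big_split; apply: eq_bigr => i _.
by rewrite -[X in X * _]/(hit _ h) hit_psi mulrDl -scalerAl scalerAr.
Qed.

(** * Degrees *)

(** The coradical filtration with its index shifted by one: [filt 0] is zero and
[filt n.+1] consists of the elements of degree at most [n], so that the zero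
element has a degree below all others. *)
Fixpoint filt n h : Prop :=
  if n is n'.+1 then forall phi, augmented phi -> filt n' (hit phi h) else h = 0.

Lemma filt_lin n c h g : filt n h -> filt n g -> filt n (c *: h + g).
Proof.
elim: n h g => [|n IHn] h g /=; first by move=> -> ->; rewrite scaler0 addr0.
move=> hn gn phi phiA; have [phiL _] := phiA.
by rewrite hitD // hitZ //; apply: IHn; [apply: hn | apply: gn].
Qed.

Lemma filt0 n : filt n 0.
Proof. by elim: n => //= n IHn phi [phiL _]; rewrite hit0. Qed.

Lemma filtZ n c h : filt n h -> filt n (c *: h).
Proof. by move=> hn; rewrite -[_ *: _]addr0; apply: filt_lin (filt0 n). Qed.

Lemma filtD n h g : filt n h -> filt n g -> filt n (h + g).
Proof. by rewrite -{2}[h]scale1r; apply: filt_lin. Qed.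

Lemma filtB n h g : filt n h -> filt n g -> filt n (h - g).
Proof. by move=> hn gn; rewrite addrC -scaleN1r; apply: filt_lin. Qed.

Lemma filt_sum n m (F : 'I_m -> H) : (forall i, filt n (F i)) -> filt n (\sum_i F i).
Proof. by move=> Fn; apply: big_ind => //; [apply: filt0 | apply: filtD]. Qed.

Lemma filtS n h : filt n h -> filt n.+1 h.
Proof.
elim: n h => [|n IHn] h; first by move=> -> ; apply: filt0.
by move=> hn phi phiA; apply/IHn/hn.
Qed.

Lemma filtW n m h : (n <= m)%N -> filt n h -> filt m h.
Proof.
move/subnKC <-; elim: (m - n)%N => [|d IHd] hn; first by rewrite addn0.
by rewrite addnS; apply/filtS/IHd.
Qed.

(** The coefficient of [h] outside the scalars would be seen by an augmented
functional [phi], but [phi h] is the counit of [hit phi h]. *)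
Lemma filt1P h : filt 1 h <-> h = eps h *: 1.
Proof.
split=> [h1|-> phi [phiL phi1]]; last by rewrite /= hitZ // hit1 // phi1 scale0r scaler0.
apply/eqP; rewrite -subr_eq0; apply: contraT => /separating_scalar [f fL fh].
pose phi x := f x + (- f 1) * eps x.
have phiA : augmented phi.
  by split; [apply: scalar_comb | rewrite /phi eps1 mulr1 subrr].
have := eps_hit h phiA.1; rewrite (h1 _ phiA) scalarf0 //.
have -> : phi h = f (h - eps h *: 1).
  by rewrite addrC -scaleNr fL addrC mulNr mulrC -mulNr.
by move/eqP; rewrite fh eq_sym oner_eq0.
Qed.

Lemma filt_iter_hit phi m n h : augmented phi ->
  filt (m + n) h -> filt m (iter n (hit phi) h).
Proof.
move=> phiA; elim: n h => [|n IHn] h; first by rewrite addn0.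
by rewrite addnS iterSr => hn; apply/IHn/hn.
Qed.

(** Each term of [hit_mul_rule] has total degree at most [n + m - 1]. *)
Lemma filtM n m h g : filt n.+1 h -> filt m.+1 g -> filt (n + m).+1 (h * g).
Proof.
have [N] := ubnP (n + m); elim: N n m h g => // N IHN n m h g le_nm hn gm.
have step n' m' h' g' : (n' + m' <= n + m)%N -> filt n' h' -> filt m'.+1 g' ->
    filt (n' + m') (h' * g').
  case: n' => [|n'] le' hn' gm'; first by rewrite hn' mul0r; apply: filt0.
  by apply: IHN => //; apply: leq_trans le' _.
have step' h' g' : filt n.+1 h' -> filt m g' -> filt (n + m) (h' * g').
  case: m {gm} le_nm step => [|m] le_nm _ hn' gm'.
    by rewrite gm' mulr0; apply: filt0.
  by rewrite addnS; apply: IHN => //; rewrite -addnS.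
move=> phi phiA.
have [r [psi [omega [psiA omegaA ->]]]] := hit_mul_rule h g phiA.
apply: filtD; first apply: filtD.
- by apply: step' => //; apply: gm.
- by apply: step => //; apply: hn.
- by apply: filt_sum => i; apply: step => //; [apply: hn | apply/filtS/gm].
Qed.

Lemma iter_hitD phi n h g : scalar phi ->
  iter n (hit phi) (h + g) = iter n (hit phi) h + iter n (hit phi) g.
Proof. by move=> phiL; elim: n => //= n ->; rewrite hitD. Qed.

Lemma iter_hitZ phi n c h : scalar phi ->
  iter n (hit phi) (c *: h) = c *: iter n (hit phi) h.
Proof. by move=> phiL; elim: n => //= n ->; rewrite hitZ. Qed.

(** In the iterated rule [hit_mul_rule] only the terms survive in which [n] of the
[n + m] operators hit [h] and the others hit [g]; their number is the binomial
coefficient. *)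
Lemma iter_hit_mul phi n m h g : augmented phi -> filt n.+1 h -> filt m.+1 g ->
  iter (n + m) (hit phi) (h * g) =
  (iter n (hit phi) h * iter m (hit phi) g) *+ 'C(n + m, n).
Proof.
move=> phiA; have [phiL _] := phiA.
have [N] := ubnP (n + m); elim: N n m h g => // N IHN [|n] m h g le_nm.
  move=> /filt1P -> _; rewrite bin0 mulr1n /=.
  by rewrite -!scalerAl !mul1r iter_hitZ.
case: m le_nm => [|m] le_nm hn.
  move=> /filt1P ->; rewrite addn0 binn mulr1n.
  by rewrite -[iter 0 _ _]/(_ *: 1) -!scalerAr !mulr1 iter_hitZ.
move=> gm.
have [r [psi [omega [psiA omegaA hitE]]]] := hit_mul_rule h g phiA.
rewrite addSn iterSr hitE !iter_hitD //.
have -> : iter (n + m.+1) (hit phi)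
    (\sum_(i < r) hit (psi i) h * hit (omega i) g) = 0.
  apply: (filt_iter_hit (m := 0)) => //; apply: filt_sum => i.
  by rewrite addnS; apply: filtM; [apply: hn | apply: gm].
have -> : iter (n + m.+1) (hit phi) (h * hit phi g) =
    (iter n.+1 (hit phi) h * iter m (hit phi) (hit phi g)) *+ 'C(n.+1 + m, n.+1).
  rewrite addnS -addSn; apply: IHN hn _; last exact: gm.
  by rewrite addSnnS.
rewrite IHN //; last exact: hn.
by rewrite addr0 -!iterSr addnS -mulrnDr addSn binS.
Qed.

(** Generators have degree at most one, as they are primitive. *)
Lemma filt_exhaustive h : exists n, filt n.+1 h.
Proof.
apply: (enveloping_ind (S := fun h => exists n, filt n.+1 h) _ _ _ H_env).
- by exists 0%N; apply/filt1P; rewrite eps1 scale1r.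
- move=> c x y [n xn] [m ym]; exists (maxn n m).
  by apply: filt_lin; [apply: filtW xn | apply: filtW ym];
    rewrite ltnS ?leq_maxl ?leq_maxr.
- by move=> x y [n xn] [m ym]; exists (n + m)%N; apply: filtM.
- move=> x; exists 1%N => phi [phiL phi1].
  rewrite /hit Delta_cop contrD // !contrE // phi1 scale0r add0r.
  by apply: (@filtZ 1); apply/filt1P; rewrite eps1 scale1r.
Qed.

(** The symbol of degree [n] of [h] restricted to the line [phi + s psi], as a
polynomial in [s], see [horner_line_poly]. *)
Fixpoint line_poly phi psi n h : {poly k} :=
  if n is n'.+1 then
    line_poly phi psi n' (hit phi h) + 'X * line_poly phi psi n' (hit psi h)
  else (eps h)%:P.
Arguments line_poly : simpl never.

Section LinePoly.
Context (phi psi : H -> k) (phiL : scalar phi) (psiL : scalar psi).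

Lemma horner_line_poly n h s : (line_poly phi psi n h).[s] =
  eps (iter n (hit (fun x => phi x + s * psi x)) h).
Proof.
have L := scalar_comb s phiL psiL.
elim: n h => [|n IHn] h; first by rewrite hornerC.
rewrite hornerD hornerM hornerX !IHn iterSr hit_comb // iter_hitD // iter_hitZ //.
by rewrite scalarfD // (scalarfZ epsL).
Qed.

Lemma size_line_poly n h : (size (line_poly phi psi n h) <= n.+1)%N.
Proof.
elim: n h => [|n IHn] h; first exact: size_polyC_leq1.
apply: leq_trans (size_polyD _ _) _; rewrite geq_max (leq_trans (IHn _)) //=.
by apply: leq_trans (size_polyMleq _ _) _; rewrite size_polyX ltnS IHn.
Qed.

Lemma coef0_line_poly n h :
  (line_poly phi psi n h)`_0 = eps (iter n (hit phi) h).
Proof.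
elim: n h => [|n IHn] h; first by rewrite coefC.
by rewrite coefD coefXM addr0 IHn iterSr.
Qed.

Lemma coef1_line_poly n h :
  (line_poly phi psi n.+1 h)`_1 = n.+1%:R * eps (iter n (hit phi) (hit psi h)).
Proof.
elim: n h => [|n IHn] h.
  by rewrite /line_poly coefD coefXM !coefC add0r mul1r.
rewrite -[line_poly _ _ n.+2 h]/(line_poly _ _ n.+1 _ + 'X * line_poly _ _ n.+1 _).
rewrite coefD coefXM /= IHn coef0_line_poly.
by rewrite hitC // -iterSr -[n.+2]addn1 natrD mulrDl mul1r.
Qed.

Lemma coefn_line_poly n h :
  (line_poly phi psi n h)`_n = eps (iter n (hit psi) h).
Proof.
elim: n h => [|n IHn] h; first by rewrite coefC.
by rewrite coefD coefXM IHn iterSr [_`_n.+1]nth_default ?size_line_poly // add0r.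
Qed.

End LinePoly.

Context (k_char0 : [pchar k] =i pred0).

Lemma augmented_comb phi psi c : augmented phi -> augmented psi ->
  augmented (fun x => phi x + c * psi x).
Proof.
move=> [phiL phi1] [psiL psi1]; split; first exact: scalar_comb.
by rewrite phi1 psi1 mulr0 addr0.
Qed.

(** The symbol vanishes on every line [phi + s psi], and its derivative at
[s = 0] is [n] times the symbol of [hit psi h] at [phi].  By induction
[hit psi h] has smaller degree, for each [psi]. *)
Lemma filt_polarization n h : filt n.+1 h ->
  (forall phi, augmented phi -> iter n (hit phi) h = 0) -> filt n h.
Proof.
elim: n h => [|n IHn] h hn h0.
  by apply: (h0 (fun=> 0)); split=> // c x y; rewrite mulr0 addr0.
move=> psi psiA; apply: IHn => [|phi phiA]; first exact: hn.
have /filt1P -> : filt 1 (iter n (hit phi) (hit psi h)).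
  by apply: filt_iter_hit => //; apply: hn.
have /(congr1 (fun p : {poly k} => p`_1)) : line_poly phi psi n.+1 h = 0.
  apply: contrapT => /eqP/(char0_nonroot k_char0) [s].
  rewrite /root horner_line_poly ?h0 ?scalarf0 ?eqxx //;
    by [apply: augmented_comb | case: phiA | case: psiA].
rewrite coef1_line_poly ?coef0; [|by case: phiA|by case: psiA].
move/eqP; rewrite mulf_eq0 ((pcharf0P k).1 k_char0) /= => /eqP ->.
exact: scale0r.
Qed.

Lemma filt_symbol n h : filt n.+1 h -> ~ filt n h ->
  exists2 phi, augmented phi & eps (iter n (hit phi) h) != 0.
Proof.
move=> hn nhn; apply: contrapT => no; apply/nhn/filt_polarization => // phi phiA.
have /filt1P -> : filt 1 (iter n (hit phi) h) by apply: filt_iter_hit.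
have [->|ne0] := eqVneq (eps (iter n (hit phi) h)) 0; first exact: scale0r.
by case: no; exists phi.
Qed.

(** Symbols that do not vanish at [phi] and at [psi], respectively, give nonzero
polynomials on the line through [phi] and [psi]; a point where both are nonzero
is one where the symbol of the product is nonzero. *)
Lemma filt_mul_neq n m h g : filt n.+1 h -> ~ filt n h ->
  filt m.+1 g -> ~ filt m g -> ~ filt (n + m) (h * g).
Proof.
move=> hn nhn gm ngm.
have [phi phiA h0] := filt_symbol hn nhn.
have [psi psiA g0] := filt_symbol gm ngm.
have [[phiL _] [psiL _]] := (phiA, psiA).
have p0 : line_poly phi psi n h != 0.
  by apply: contraNneq h0 => p0; rewrite -(coef0_line_poly phi psi) p0 coef0.
have q0 : line_poly phi psi m g != 0.
  by apply: contraNneq g0 => q0; rewrite -(coefn_line_poly phi) q0 coef0.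
have [s] := char0_nonroot k_char0 (mulf_neq0 p0 q0).
rewrite rootM !/(root _ _) !horner_line_poly // negb_or => /andP[hs gs] hgnm.
have thetaA := augmented_comb s phiA psiA.
have := iter_hit_mul thetaA hn gm.
rewrite (filt_iter_hit (m := 0) thetaA hgnm).
move/(congr1 eps)/esym/eqP; rewrite scalarf0 // -scaler_nat scalarfZ // epsM.
rewrite !mulf_eq0 (negbTE hs) (negbTE gs) ((pcharf0P k).1 k_char0) orbF.
by rewrite -leqn0 leqNgt bin_gt0 leq_addr.
Qed.

(** * Degree estimates for tensors *)

Lemma filt_deg h : h != 0 -> exists2 n, filt n.+1 h & ~ filt n h.
Proof.
move=> /eqP h0; have [N hN] := filt_exhaustive h.
elim: N hN => [|N IHN] hN; first by exists 0%N.
by have [/IHN //|nhN] := pselect (filt N.+1 h); exists N.+1.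
Qed.

Lemma mul_eq0_domain h g : h * g = 0 -> h = 0 \/ g = 0.
Proof.
move=> hg0; have [->|h0] := eqVneq h 0; [by left | right].
have [//|g0] := eqVneq g 0.
have [[n hn nhn] [m gm ngm]] := (filt_deg h0, filt_deg g0).
by case: (filt_mul_neq hn nhn gm ngm); rewrite hg0; apply: filt0.
Qed.

(** Two nonzero elements whose product has degree zero have degree zero. *)
Lemma filt1_mul h g : h != 0 -> g != 0 -> filt 1 (h * g) -> filt 1 h /\ filt 1 g.
Proof.
move=> h0 g0 hg1.
have [[n hn nhn] [m gm ngm]] := (filt_deg h0, filt_deg g0).
case: n m hn nhn gm ngm => [|n] [|m] hn nhn gm ngm //;
  by case: (filt_mul_neq hn nhn gm ngm); apply: filtW hg1; rewrite ?addnS.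
Qed.

Lemma filtMr n m h g : filt n.+1 h -> filt m g -> filt (n + m) (h * g).
Proof.
case: m => [|m] hn gm; first by rewrite gm mulr0; apply: filt0.
by rewrite addnS; apply: filtM.
Qed.

(** The degree in the left factor of a nonzero tensor exists, since finitely many
elements occur in it. *)
Lemma tensor_deg u : u != 0 ->
  exists p, (forall chi, scalar chi -> filt p.+1 (contr chi u)) /\
    exists2 chi, scalar chi & ~ filt p (contr chi u).
Proof.
move=> /eqP u0; have [N uN] : exists N, forall chi, scalar chi -> filt N.+1 (contr chi u).
  elim/otimes_ind: {u0} u => [|a b|u v [n un] [m vm]].
  - by exists 0%N => chi chiL; rewrite contr0 //; apply: filt0.
  - have [n an] := filt_exhaustive a; exists n => chi chiL.
    by rewrite contrE //; apply: filtZ.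
  - exists (maxn n m) => chi chiL; rewrite contrD //.
    by apply: filtD; [apply: filtW (un _ chiL) | apply: filtW (vm _ chiL)];
      rewrite ltnS ?leq_maxl ?leq_maxr.
have next p : (forall chi, scalar chi -> filt p (contr chi u)) \/
    exists2 chi, scalar chi & ~ filt p (contr chi u).
  have [all|nall] := pselect (forall chi, scalar chi -> filt p (contr chi u)).
    by left.
  right; apply: contrapT => none; apply: nall => chi chiL.
  by apply: contrapT => nchi; apply: none; exists chi.
elim: N uN => [|N IHN] uN.
  by case: (next 0%N) => [/contr_inj //|]; exists 0%N.
by case: (next N.+1) => [/IHN //|]; exists N.+1.
Qed.

(** If [u] has degree [p] in its left factor and [g] has degree [q], then
[u * Delta g] has degree [p + q] there: by [contr_mul_Delta] a slice of it is
the same slice of [u] times [g], up to lower degree.  So the degree can only fail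
to grow if [q = 0]. *)
Lemma contr_mul_Delta_const u g : u != 0 ->
  (forall p, (forall chi, scalar chi -> filt p.+1 (contr chi u)) ->
     forall chi, scalar chi -> filt p.+1 (contr chi (u * Delta g))) ->
  filt 1 g.
Proof.
move=> u0 deg_le; have [->|g0] := eqVneq g 0; first exact: filt0.
have [p [up [chi chiL nup]]] := tensor_deg u0.
have [[|q] gq ngq] := filt_deg g0; first exact: gq.
have [n [e [omega [omegaA gE]]]] := contr_mul_Delta g.
have := deg_le p up chi chiL; rewrite gE // => top.
case: (filt_mul_neq (up _ chiL) nup gq ngq).
have L i : scalar (fun b => chi (b * e i)).
  by move=> c x y; rewrite mulrDl -scalerAl chiL.
rewrite -[_ * g](addrK (\sum_(i < n) contr (fun b => chi (b * e i)) u * hit (omega i) g)).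
apply: filtB; first by apply: filtW top; rewrite addnS ltnS leq_addr.
by apply: filt_sum => i; apply: filtMr; [apply/up/L | apply: gq].
Qed.

(** Every functional is its value at [1] times the counit, plus an augmented
functional; so the slices of [z] are multiples of a single one. *)
Lemma contr_augmented (z : H \ox H) :
  (forall omega, augmented omega -> contr omega z = 0) ->
  z = contr eps z \ox 1.
Proof.
move=> z0; have [n [e [phi [phiL zE oneE]]]] := contr_expand z 1.
have phi_eps i : contr (phi i) z = phi i 1 *: contr eps z.
  apply/eqP; rewrite -subr_eq0 -scaleNr -contr_comb //; apply/eqP/z0.
  by split; [apply: scalar_comb | rewrite eps1 mulr1 subrr].
rewrite [LHS]zE [X in _ \ox X]oneE.
rewrite (big_morph (fun b => contr eps z \ox b) (otimesDr _) (otimes0r H _)).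
by apply: eq_bigr => i _; rewrite phi_eps otimesZ.
Qed.

Lemma filt1_tswap (z : H \ox H) :
  (forall phi, scalar phi -> filt 1 (contr phi (tswap z))) ->
  z = contr eps z \ox 1.
Proof.
move=> z1; apply: contr_augmented => omega [omegaL omega1].
apply/eqP; apply: contraT => /separating_scalar [f fL /eqP].
rewrite contr_tswap //; have /filt1P -> := z1 f fL.
by rewrite scalarfZ // omega1 mulr0 eq_sym oner_eq0.
Qed.

(** In [(1 (x) x) (id (x) Delta) y] the second and third factors are [x] times the
coproduct of the right factor of [y].  So slicing the first factor, too, replaces
[y] by an element of [H], while slicing the last two factors gives a slice of
[y]. *)
Section Nested.
Context (chi : H -> k) (chiL : scalar chi) (x : H \ox H).

Lemma contr_nested (a b : H) :
  contr chi (tassoc (1 \ox x) * tassoc (tmap idfun Delta (a \ox b))) =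
  a \ox contr chi (x * Delta b).
Proof. by rewrite -rmorphM tmapE /= otimesM mul1r contr_tassoc. Qed.

Lemma contr_nested_left phi (y : H \ox H) : scalar phi ->
  contr phi (tswap (contr chi (tassoc (1 \ox x) * tassoc (tmap idfun Delta y)))) =
  contr chi (x * Delta (contr phi (tswap y))).
Proof.
move=> phiL; elim/otimes_ind: y => [|a b|u v IHu IHv].
- by rewrite !raddf0 mulr0 !contr0 // !raddf0 mulr0 !contr0.
- by rewrite contr_nested !tswapE !contrE // linearZ -scalerAr contrZ.
- rewrite !raddfD mulrDr contrD // raddfD /= contrD // IHu IHv.
  by rewrite contrD // raddfD mulrDr contrD.
Qed.

Lemma contr_nested_right phi (y : H \ox H) : scalar phi ->
  contr phi (contr chi (tassoc (1 \ox x) * tassoc (tmap idfun Delta y))) =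
  contr (fun h => phi (contr chi (x * Delta h))) y.
Proof.
move=> phiL; have L : scalar (fun h => phi (contr chi (x * Delta h))).
  by move=> c h g; rewrite linearP mulrDr -scalerAr contrD // contrZ // phiL.
elim/otimes_ind: y => [|a b|u v IHu IHv].
- by rewrite !raddf0 mulr0 !contr0.
- by rewrite contr_nested !contrE.
- by rewrite !raddfD mulrDr !contrD // IHu IHv.
Qed.

End Nested.

Lemma contr_tmap_tswap chi (w : H \ox H \ox H) : scalar chi ->
  contr chi (tmap (@tswap k H H) idfun w) = tswap (contr chi w).
Proof.
move=> chiL; elim/otimes_ind: w => [|a b|u v IHu IHv].
- by rewrite raddf0 !contr0 // raddf0.
- by rewrite tmapE !contrE // linearZ.
- by rewrite raddfD !contrD // raddfD /= IHu IHv.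
Qed.

(** For a slice [g] of [b] in its left factor, the degree of [b * Delta g] in its
left factor is the degree of [b] plus that of [g].  By symmetry its slices are
also slices of [b].  So [g] has degree zero. *)
Lemma symmetric_nested_square (b : H \ox H) :
  tmap (@tswap k H H) idfun (tassoc (1 \ox b) * tassoc (tmap idfun Delta b)) =
    tassoc (1 \ox b) * tassoc (tmap idfun Delta b) ->
  b = contr eps b \ox 1.
Proof.
move=> sym; apply: filt1_tswap => phi phiL.
have [->|b0] := eqVneq b 0; first by rewrite raddf0 contr0 //; apply: filt0.
apply: (contr_mul_Delta_const b0) => p bp chi chiL.
rewrite -contr_nested_left // -contr_tmap_tswap // sym contr_nested_right //.
apply: bp => c x y; rewrite linearP mulrDr -scalerAr contrD // contrZ //.
exact: phiL.
Qed.

(** For every left slice [g] of [a] the product [d * Delta g] is constant in its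
right factor.  By additivity of degrees so is [d], unless some factor is zero, and
[g] is a scalar. *)
Lemma nested_product_const (d a w : H \ox H) :
  tassoc (1 \ox d) * tassoc (tmap idfun Delta a) = w \ox 1 ->
  [\/ d = 0, a = 0 | d = contr eps d \ox 1 /\ a = contr eps a \ox 1].
Proof.
move=> dawE; have [->|d0] := eqVneq d 0; first by constructor 1.
have [->|a0] := eqVneq a 0; first by constructor 2.
constructor 3.
have top0 omega phi : augmented omega -> scalar phi ->
    contr omega (d * Delta (contr phi (tswap a))) = 0.
  move=> [omegaL omega1] phiL.
  by rewrite -contr_nested_left // dawE contrE // omega1 scale0r raddf0 contr0.
have a1 phi : scalar phi -> filt 1 (contr phi (tswap a)).
  move=> phiL; apply: (contr_mul_Delta_const (u := tswap d)).
    by apply: contraNneq d0 => d0; rewrite -[d]tswapK d0 raddf0.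
  move=> p _ chi chiL; apply: (@filtW 1) => //.
  rewrite -cocomm -rmorphM (contr_augmented (z := d * _)).
    by rewrite /= tswapE contrE //; apply: (@filtZ 1); apply/filt1P; rewrite eps1 scale1r.
  by move=> omega omegaA; apply: top0.
split; last exact: filt1_tswap.
apply: contr_augmented => omega omegaA.
have [phi phiL aphi0] : exists2 phi, scalar phi & contr phi (tswap a) <> 0.
  apply: contrapT => none; case/eqP: a0; rewrite -[a]tswapK.
  rewrite [tswap a]contr_inj ?raddf0 // => phi phiL.
  by apply: contrapT => aphi0; apply: none; exists phi.
have := top0 _ _ omegaA phiL; have /filt1P aphiE := a1 _ phiL.
move: aphi0; rewrite aphiE linearZ rmorph1 -scalerAr mulr1 contrZ; last by case: omegaA.
move=> aphi0 /eqP; rewrite scaler_eq0 => /orP[/eqP e0|/eqP //].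
by case: aphi0; rewrite e0 scale0r.
Qed.

(** * Solving the equations for the coefficients *)

Local Notation D1 u := (tmap Delta idfun u : H \ox H \ox H).
Local Notation D2 u := (tassoc (tmap idfun Delta (u : H \ox H)) : H \ox H \ox H).
Local Notation I23 u := (tassoc ((1 : H) \ox (u : H \ox H)) : H \ox H \ox H).
Local Notation sw w := (tmap (@tswap k H H) idfun (w : H \ox H \ox H)).

Lemma Delta1_left h : D1 (h \ox 1) = Delta h \ox 1.
Proof. by rewrite tmapE. Qed.

Lemma Delta2_left h : D2 (h \ox 1) = h \ox 1 \ox 1.
Proof. by rewrite tmapE /= rmorph1 -[X in h \ox X]/(1 \ox 1) tassocE. Qed.

Lemma swap12_left u : sw (u \ox 1) = tswap u \ox 1.
Proof. by rewrite tmapE. Qed.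

Lemma contr_eps_left (A : algType k) (u : A) : contr eps (u \ox (1 : H)) = u.
Proof. by rewrite contrE // eps1 scale1r. Qed.

(** The coefficient of [e1] in the pre-Lie identity at [(e1, e2, e1)], for
[e1 * e1 = t e1]; exchanging the roles of [e1] and [e2] gives the coefficient of
[e2] at [(e2, e1, e2)]. *)
Definition mixed_eq t (a b c d : H \ox H) : Prop :=
  t *: (a \ox (1 : H)) + (b \ox 1) * D1 c - t *: I23 c - I23 d * D2 a =
  sw (t *: (c \ox 1) + (d \ox 1) * D1 c - t *: D2 c).

(** The coefficient of [e2] in the pre-Lie identity at [(e1, e2, e1)]. *)
Definition action_eq t (b d : H \ox H) : Prop :=
  (b \ox (1 : H)) * D1 d - I23 d * D2 b = sw ((d \ox 1) * D1 d - t *: D2 d).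

Lemma mixed_eq_left t a f g d : mixed_eq t a (f \ox 1) (g \ox 1) d ->
  I23 d * D2 a =
  (t *: a + (f \ox 1) * Delta g - t *: (1 \ox g) - tswap d * Delta g) \ox 1.
Proof.
rewrite /mixed_eq Delta1_left Delta2_left tassocE !otimesM !mulr1.
rewrite [X in _ = tmap _ _ X]addrAC subrr add0r swap12_left rmorphM /= cocomm.
move=> eqX; rewrite !otimesBl otimesDl -!scale_otimesl -eqX.
by rewrite opprB [RHS]addrC subrK.
Qed.

Lemma otimes_constant (c : k) : (c *: 1 : H \ox H) \ox (1 : H) = c *: 1.
Proof. by rewrite -scale_otimesl. Qed.

Lemma Delta1_constant (c : k) : D1 (c *: 1) = c *: 1.
Proof. by rewrite linearZ rmorph1. Qed.

Lemma Delta2_constant (c : k) : D2 (c *: 1) = c *: 1.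
Proof. by rewrite !linearZ /= !rmorph1. Qed.

Lemma tassoc_constant (c : k) : I23 (c *: 1) = c *: 1.
Proof.
rewrite -scale_otimesr linearZ /=; congr (_ *: _).
exact: (rmorph1 (@tassoc k H H H)).
Qed.

Lemma swap12_constant (c : k) : sw (c *: 1) = c *: 1.
Proof. by rewrite linearZ rmorph1. Qed.

Definition constantsE := (otimes_constant, Delta1_constant, Delta2_constant,
  tassoc_constant, swap12_constant).

Lemma scale1_inj (R : algType k) : injective (fun c : k => c *: (1 : R)).
Proof.
move=> x y /eqP; rewrite -subr_eq0 -scalerBl scaler_eq0 oner_eq0 orbF subr_eq0.
by move/eqP.
Qed.

Lemma action_eq_constants t (b d : k) :
  action_eq t (b *: 1) (d *: 1) <-> b * d - d * b = d * d - t * d.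
Proof.
have lhsE (R : algType k) : (b *: 1) * (d *: 1) - (d *: 1) * (b *: 1)
    = (b * d - d * b) *: 1 :> R.
  by rewrite -!scalerAl !mul1r !scalerA -!scalerBl.
have rhsE (R : algType k) : (d *: 1) * (d *: 1) - t *: (d *: 1)
    = (d * d - t * d) *: 1 :> R.
  by rewrite -!scalerAl !mul1r !scalerA -!scalerBl.
rewrite /action_eq !otimes_constant Delta1_constant !Delta2_constant tassoc_constant.
rewrite lhsE rhsE swap12_constant.
by split=> [/scale1_inj|->].
Qed.

(** The values of [(b, c, d)] when [a = 0]. *)
Definition corner_table (t1 t2 : k) : seq (k * k * k) :=
  [:: (0, 0, 0); (t1, t2, 0); (t1, 0, t1); (2 * t1, 2^-1 * t2, t1)].

Lemma natr_neq0 n : n.+1%:R != 0 :> k.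
Proof. by rewrite ((pcharf0P k).1 k_char0). Qed.

(** An augmented [phi] makes [phi f *: f] drop in degree, so [phi f = 0] and hence
[hit phi f = 0]; therefore [f] is a scalar. *)
Lemma group_like_scaled t f : t != 0 ->
  (forall phi, scalar phi -> t *: hit phi f = phi f *: f) ->
  f = 0 \/ f = t *: 1.
Proof.
move=> t0 fE; have [->|f0] := eqVneq f 0; [by left | right].
have [n fn nfn] := filt_deg f0.
have /filt1P f1 : filt 1 f.
  move=> phi phiA; have := fE phi phiA.1.
  have [phif0 /eqP|phif0 fhit] := eqVneq (phi f) 0.
    by rewrite phif0 scale0r scaler_eq0 (negbTE t0) => /eqP.
  case: nfn; rewrite -[f]scale1r -(mulVf phif0) -scalerA -fhit.
  by apply/filtZ/filtZ/fn.
have := fE eps epsL; rewrite [hit eps f]counit // => /eqP.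
by rewrite -subr_eq0 -scalerBl scaler_eq0 (negbTE f0) orbF subr_eq0 => /eqP ->.
Qed.

Section Corner.
Context (t1 t2 : k) (t1_neq0 : t1 != 0) (t2_neq0 : t2 != 0).

(** Eliminating [d] gives [g * (f * g - t1 * t2) = 0].  If [g = 0], then
[d = 1 (x) f] and [f / t1] is group-like or zero.  Otherwise [f] and [g] are
inverse to each other up to a scalar, hence scalars, and [d] is the scalar
[f - t1], for which [action_eq] is a quadratic equation. *)
Lemma corner_classification f g d :
  mixed_eq t1 0 (f \ox 1) (g \ox 1) d -> mixed_eq t2 d (g \ox 1) (f \ox 1) 0 ->
  action_eq t1 (f \ox 1) d ->
  exists2 s, s \in corner_table t1 t2 &
    [/\ f = s.1.1 *: 1, g = s.1.2 *: 1 & d = s.2 *: 1].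
Proof.
move=> /mixed_eq_left mix1 /mixed_eq_left mix2 act1.
move: mix1; rewrite raddf0 [tassoc 0]raddf0 mulr0 => /(congr1 (contr eps)).
rewrite contr0 // contr_eps_left scaler0 add0r => /esym/eqP.
rewrite subr_eq0 => /eqP mix1.
move: mix2; rewrite otimes0r [tassoc 0]raddf0 mul0r => /(congr1 (contr eps)).
rewrite contr0 // contr_eps_left [tswap 0]raddf0 mul0r subr0 => /esym/eqP.
rewrite subr_eq0 => /eqP mix2.
have dE : t2 *: d = t2 *: (1 \ox f) - (g \ox 1) * Delta f by rewrite -mix2 addrK.
have tdE : t2 *: tswap d = t2 *: (f \ox 1) - (1 \ox g) * Delta f.
  transitivity (tswap (t2 *: d)); first by rewrite linearZ.
  rewrite dE raddfB /= linearZ rmorphM /= !tswapE.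
  by rewrite cocomm.
(* the value of [d] is substituted into mix1, multiplied by [t2] *)
have fgE : (1 \ox g) * Delta (f * g) = (t1 * t2) *: (1 \ox g).
  have := congr1 (fun u => t2 *: u) mix1; rewrite scalerAl tdE mulrBl -mulrA -rmorphM.
  rewrite scalerBr -scalerAl scalerA [t2 * t1]mulrC.
  by move=> /addrI/oppr_inj.
have gfgE : g * (f * g - (t1 * t2) *: 1) = 0.
  have := congr1 (fun u => contr eps (tswap u)) fgE.
  rewrite rmorphM linearZ /= cocomm !tswapE contr_epsM contrZ // !contrE //.
  rewrite [contr eps _]counit eps1 !scale1r => gfgE.
  by rewrite mulrBr gfgE -scalerAr mulr1 subrr.
have unscale2 : cancel (fun u : H \ox H => t2 *: u) (fun u => t2^-1 *: u).
  by move=> u; rewrite scalerA mulVf // scale1r.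
case/mul_eq0_domain: gfgE => [g0|/eqP].
  move: act1 dE; rewrite {}g0 otimes0l mul0r subr0 => act1 /(can_inj unscale2) dE.
  have /group_like_scaled : forall phi, scalar phi -> t1 *: hit phi f = phi f *: f.
    move=> phi phiL; move: act1; rewrite /action_eq dE Delta2_left.
    rewrite !tmapE /= rmorph1 tassocE !otimesM !mul1r !mulr1 subrr.
    move/(congr1 (fun w => contr eps (contr phi w))).
    rewrite !contr0 // contr_tmap_tswap // contrB // contrE // contrZ //.
    rewrite contr_tassoc // raddfB /= !linearZ /= !tswapE scalerN contrB // !contrZ //.
    by rewrite !contr_eps_left => /esym/eqP; rewrite subr_eq0 => /eqP.
  case=> // fE.
    exists (0, 0, 0); first by rewrite !inE eqxx.
    by rewrite dE fE otimes0r !scale0r.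
  exists (t1, 0, t1); first by rewrite !inE eqxx !orbT.
  by rewrite dE fE -scale_otimesr scale0r.
rewrite subr_eq0 => /eqP fg1.
have fg0 : f * g != 0 by rewrite fg1 scaler_eq0 oner_eq0 orbF mulf_neq0.
have f0 : f != 0 by apply: contraNneq fg0 => ->; rewrite mul0r.
have g0 : g != 0 by apply: contraNneq fg0 => ->; rewrite mulr0.
have fg_1 : filt 1 (f * g).
  by rewrite fg1; apply: (@filtZ 1); apply/filt1P; rewrite eps1 scale1r.
have [/filt1P] := filt1_mul f0 g0 fg_1.
move: (eps f) => beta fE /filt1P; move: (eps g) => gamma gE.
rewrite {}fE {}gE in act1 dE fg1 *.
have {}fg1 : beta * gamma = t1 * t2.
  by apply: (@scale1_inj H); rewrite -fg1 -scalerAl mul1r scalerA.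
have {}dE : d = (beta - t1) *: 1.
  apply: (can_inj unscale2); rewrite dE linearZ /= rmorph1 -scalerAr mulr1.
  rewrite -scale_otimesr -scale_otimesl !scalerA -scalerBl fg1 mulrBr.
  by rewrite [t1 * t2]mulrC.
move: act1; rewrite dE -scale_otimesl => /action_eq_constants.
rewrite mulrC subrr => /esym/eqP; rewrite -mulrBl mulf_eq0 subr_eq0 orbC subr_eq0.
have two0 := natr_neq0 1.
case/orP=> /eqP betaE.
  exists (t1, t2, 0); first by rewrite !inE eqxx !orbT.
  rewrite betaE subrr; split=> //; congr (_ *: _).
  by apply: (mulfI t1_neq0); rewrite -fg1 betaE.
have {}betaE : beta = 2 * t1 by rewrite -[beta](subrK t1) betaE mulr2n mulrDl mul1r.
exists (2 * t1, 2^-1 * t2, t1); first by rewrite !inE eqxx !orbT.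
rewrite betaE mulr2n mulrDl mul1r addrK; split=> //; congr (_ *: _).
apply: (mulfI (mulf_neq0 two0 t1_neq0)).
by rewrite -betaE fg1 betaE mulrACA mulfV // mul1r.
Qed.

Lemma contr_eps1 : contr eps (1 : H \ox H \ox H) = 1.
Proof. exact: contr_eps_left. Qed.

(** Counits in the outer factors turn [action_eq] into [h * h = t *: h]. *)
Lemma action_eq_left t f h : action_eq t (f \ox 1) (h \ox 1) -> h = 0 \/ h = t *: 1.
Proof.
rewrite /action_eq Delta1_left !Delta2_left tassocE !otimesM !mulr1 mul1r.
move/(congr1 (fun w => contr eps (tswap (contr eps w)))).
rewrite contr_tmap_tswap // tswapK !contrB // !contrZ // !contr_eps_left.
rewrite raddfB /= rmorphM /= cocomm !tswapE contrB // !contr_epsM !contrE //.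
rewrite ![contr eps _]counit eps1 scale1r -scalerAl mul1r subrr.
move=> /esym hE; case: (@mul_eq0_domain h (h - t *: 1)) => [|->|/eqP].
- by rewrite mulrBr -scalerAr mulr1.
- by left.
- by rewrite subr_eq0 => /eqP; right.
Qed.

(** For [g] nonzero the two counits give [eps f = 2 t] and
[(f - t) g = t * eps g]; by degrees [f - t] is a scalar. *)
Lemma interior_factor t f g : t != 0 ->
  (f \ox 1) * Delta g = t *: (1 \ox g) + t *: Delta g -> g = 0 \/ f = (2 * t) *: 1.
Proof.
move=> t0 fgE; have [->|g0] := eqVneq g 0; [by left | right].
have := congr1 (contr eps) fgE.
rewrite contr_epsM contr_eps_left contrD // !contrZ // contrE // [contr eps _]counit.
move=> fg1.
have {}fg1 : (f - t *: 1) * g = t *: (eps g *: 1).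
  by rewrite mulrBl fg1 -scalerAl mul1r addrK.
have := congr1 (fun u => contr eps (tswap u)) fgE.
rewrite rmorphM raddfD /= !linearZ /= cocomm !tswapE contr_epsM contrD // !contrZ //.
rewrite contr_eps_left contrE // [contr eps _]counit -scalerAl mul1r.
rewrite -scalerDl => /eqP; rewrite -subr_eq0 -scalerBl scaler_eq0 (negbTE g0) orbF.
rewrite subr_eq0 => /eqP epsf.
have epsft : eps (f - t *: 1) = t.
  by rewrite addrC -scaleNr epsL eps1 epsf mulr1 addKr.
have ft0 : f - t *: 1 != 0.
  by apply: contraNneq t0 => ft0; rewrite -epsft ft0 scalarf0.
have [|/filt1P] := filt1_mul ft0 g0.
  rewrite fg1 scalerA; apply: (@filtZ 1); apply/filt1P.
  by rewrite eps1 scale1r.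
rewrite epsft => /eqP; rewrite subr_eq -scalerDl => /eqP -> _.
by rewrite mulr2n mulrDl mul1r.
Qed.

Lemma interior_classification f g :
  mixed_eq t1 (t2 *: 1) (f \ox 1) (g \ox 1) (t1 *: 1) ->
  mixed_eq t2 (t1 *: 1) (g \ox 1) (f \ox 1) (t2 *: 1) ->
  (f = 0 /\ g = 0) \/ (f = (2 * t1) *: 1 /\ g = (2 * t2) *: 1).
Proof.
have factor t t' f' g' : t != 0 ->
    mixed_eq t (t' *: 1) (f' \ox 1) (g' \ox 1) (t *: 1) ->
    g' = 0 \/ f' = (2 * t) *: 1.
  move=> t0 /mixed_eq_left /(congr1 (contr eps)).
  rewrite contr_eps_left !constantsE -scalerAl mul1r !contrZ // contr_eps1.
  have -> : tswap (t *: (1 : H \ox H)) = t *: 1 by rewrite linearZ /= rmorph1.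
  rewrite -[(t *: 1) * Delta g']scalerAl mul1r -!addrA -opprD -[LHS]addr0.
  move/addrI/esym/eqP; rewrite subr_eq0 => /eqP.
  exact: interior_factor.
move=> /(factor _ _ _ _ t1_neq0) g0 /(factor _ _ _ _ t2_neq0) f0.
have nz t : t != 0 -> (2 * t) *: 1 <> 0 :> H.
  move=> t0 /eqP; rewrite scaler_eq0 oner_eq0 orbF.
  by rewrite mulf_eq0 (negbTE t0) (negbTE (natr_neq0 1)).
case: g0 => [g0|fE]; case: f0 => [f0|gE]; [by left | | | by right].
- by case: (nz _ t2_neq0); rewrite -gE.
- by case: (nz _ t1_neq0); rewrite -fE.
Qed.

(** The values of [(a, b, c, d)], in the order of the eight types. *)
Definition pre_lie_table : seq (k * k * k * k) :=
  [:: (0, 0, 0, 0); (0, t1, t2, 0); (0, t1, 0, t1); (0, 2 * t1, 2^-1 * t2, t1);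
      (t2, 0, t2, 0); (t2, 0, 0, t1); (t2, 2^-1 * t1, 2 * t2, 0);
      (t2, 2 * t1, 2 * t2, t1)].
End Corner.

Lemma coefficients_classification (t1 t2 : k) (a b c d : H \ox H) :
  t1 != 0 -> t2 != 0 ->
  sw (I23 b * D2 b) = I23 b * D2 b -> sw (I23 c * D2 c) = I23 c * D2 c ->
  mixed_eq t1 a b c d -> mixed_eq t2 d c b a -> action_eq t1 b d -> action_eq t2 c a ->
  exists2 q, q \in pre_lie_table t1 t2 &
    [/\ a = q.1.1.1 *: 1, b = q.1.1.2 *: 1, c = q.1.2 *: 1 & d = q.2 *: 1].
Proof.
move=> t1_neq0 t2_neq0 /symmetric_nested_square bE /symmetric_nested_square cE.
move: (contr eps b) (contr eps c) bE cE => f g -> -> {b c} mix1 mix2 act1 act2.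
have toHH (s : k) : (s *: 1 : H) \ox (1 : H) = s *: 1 by rewrite -scale_otimesl.
have corner_a0 : a = 0 -> exists2 q, q \in pre_lie_table t1 t2 &
    [/\ a = q.1.1.1 *: 1, f \ox (1 : H) = q.1.1.2 *: 1,
        g \ox (1 : H) = q.1.2 *: 1 & d = q.2 *: 1].
  move=> a0; rewrite a0 in mix1 mix2 *.
  have [[[x y] z] /= xyz [-> -> ->]] := corner_classification t1_neq0 t2_neq0 mix1 mix2 act1.
  exists (0, x, y, z); last by rewrite !toHH scale0r.
  by move: xyz; rewrite !inE => /or4P[]/eqP[-> -> ->]; rewrite eqxx ?orbT.
have corner_d0 : d = 0 -> exists2 q, q \in pre_lie_table t1 t2 &
    [/\ a = q.1.1.1 *: 1, f \ox (1 : H) = q.1.1.2 *: 1,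
        g \ox (1 : H) = q.1.2 *: 1 & d = q.2 *: 1].
  move=> d0; rewrite d0 in mix1 mix2 *.
  have [[[x y] z] /= xyz [-> -> ->]] := corner_classification t2_neq0 t1_neq0 mix2 mix1 act2.
  exists (z, y, x, 0); last by rewrite !toHH scale0r.
  by move: xyz; rewrite !inE => /or4P[]/eqP[-> -> ->]; rewrite eqxx ?orbT.
have [//|//|[]] := nested_product_const (mixed_eq_left mix1).
move: (contr eps d) (contr eps a) => h' h dE aE.
rewrite dE aE in mix1 act1 mix2 act2 corner_a0 corner_d0 *.
have [h'0|h'E] := action_eq_left act1; first by apply: corner_d0; rewrite h'0 otimes0l.
have [h0|hE] := action_eq_left act2; first by apply: corner_a0; rewrite h0 otimes0l.
rewrite h'E hE !toHH in mix1 mix2 *.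
have [[-> ->]|[-> ->]] := interior_classification t1_neq0 t2_neq0 mix1 mix2.
  exists (t2, 0, 0, t1); first by rewrite !inE eqxx ?orbT.
  by rewrite otimes0l !scale0r.
exists (t2, 2 * t1, 2 * t2, t1); first by rewrite !inE eqxx ?orbT.
by rewrite !toHH.
Qed.
End Coalgebra.

(** * The pre-Lie identity in coordinates *)

Section FreeScalarExtension.
Context (R S : nzRingType) (phi : {rmorphism R -> S}) (A : lmodType R) (e1 e2 : A).
Context (e_basis : basis2 e1 e2).

Lemma basis2_coord : exists xi1 xi2 : A -> R,
  [/\ linear_for *%R xi1, linear_for *%R xi2
    & forall x, x = xi1 x *: e1 + xi2 x *: e2] /\
  [/\ xi1 e1 = 1, xi1 e2 = 0, xi2 e1 = 0 & xi2 e2 = 1].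
Proof.
case: e_basis => g combK gK.
have gE a b : g (a *: e1 + b *: e2) = (a, b) by exact: (combK (a, b)).
have xE x : x = (g x).1 *: e1 + (g x).2 *: e2 by rewrite -[LHS]gK.
have gL c x y : g (c *: x + y) = (c * (g x).1 + (g y).1, c * (g x).2 + (g y).2).
  rewrite {1}[x]xE {1}[y]xE scalerDr !scalerA addrACA -!scalerDl.
  exact: gE.
have g1 : g e1 = (1, 0) by rewrite -[e1](scale1r e1) -gE scale0r addr0.
have g2 : g e2 = (0, 1) by rewrite -[e2](scale1r e2) -gE scale0r add0r.
exists (fun x => (g x).1), (fun x => (g x).2).
by rewrite g1 g2; split; split=> // c x y; rewrite gL.
Qed.

Lemma sext_basis_gen (u : sext phi A) :
  exists s1 s2, u = s1 \ox_[phi] e1 + s2 \ox_[phi] e2.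
Proof.
have [xi1 [xi2 [[_ _ xE] _]]] := basis2_coord.
elim/sexto_ind: u => [|s x|u v [s1 [s2 ->]] [r1 [r2 ->]]].
- by exists 0, 0; rewrite /sexto !tpure0l addr0.
- exists (s * phi (xi1 x)), (s * phi (xi2 x)).
  by rewrite !sextoZ -sextoDr -xE.
- by exists (s1 + r1), (s2 + r2); rewrite !sextoDl addrACA.
Qed.

Lemma sext_basis_inj s1 s2 r1 r2 :
  s1 \ox_[phi] e1 + s2 \ox_[phi] e2 = r1 \ox_[phi] e1 + r2 \ox_[phi] e2 ->
  s1 = r1 /\ s2 = r2.
Proof.
have [xi1 [xi2 [[xi1L xi2L _] [x11 x12 x21 x22]]]] := basis2_coord.
have coord xi : linear_for *%R xi -> sbalanced phi (fun s (x : A) => s * phi (xi x)).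
  move=> xiL.
  have xi0 : xi 0 = 0 by have := xiL (-1) 0 0; rewrite scaler0 addr0 mulN1r addNr.
  split=> [s s' x|s x x'|s r x]; first by rewrite mulrDl.
    by rewrite -[x]scale1r xiL mul1r rmorphD mulrDr scale1r.
  by rewrite -[r *: x]addr0 xiL xi0 addr0 rmorphM mulrA.
move=> eq12; have comp xi (xiL : linear_for *%R xi) :=
  congr1 (sext_lift (fun s x => s * phi (xi x))) eq12.
move: (comp _ xi1L) (comp _ xi2L).
rewrite !(sext_liftD (coord _ xi1L)) !(sext_liftE _ _ (coord _ xi1L)).
rewrite !(sext_liftD (coord _ xi2L)) !(sext_liftE _ _ (coord _ xi2L)).
by rewrite x11 x12 x21 x22 !(rmorph0, rmorph1, mulr0, mulr1, addr0, add0r).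
Qed.

Lemma sexto_collect (x1 x2 y1 y2 z1 z2 w1 w2 : S) :
  x1 \ox_[phi] e1 + x2 \ox_[phi] e2 + (y1 \ox_[phi] e1 + y2 \ox_[phi] e2)
    - (z1 \ox_[phi] e1 + z2 \ox_[phi] e2 + (w1 \ox_[phi] e1 + w2 \ox_[phi] e2)) =
  (x1 + y1 - (z1 + w1)) \ox_[phi] e1 + (x2 + y2 - (z2 + w2)) \ox_[phi] e2.
Proof.
have sextoN s (x : A) : (- s) \ox_[phi] x = - (s \ox_[phi] x) by exact: tpureNl.
rewrite addrACA [X in _ - X]addrACA -!sextoDl opprD addrACA -!sextoN.
by rewrite -!sextoDl.
Qed.

End FreeScalarExtension.

Section PseudoAssociator.
Context (k : fieldType) (delta : lmodType k) (br : delta -> delta -> delta).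
Context (H : algType k) (iota : {linear delta -> H}).
Context (H_env : enveloping_algebra br iota).
Context (Delta : {lrmorphism H -> H \ox H}).
Context (Delta_cop : enveloping_coproduct iota Delta).
Context (A : lmodType H) (ast : A -> A -> sext Delta A).
Context (ast_pseudo : pseudoproduct ast).

Local Notation D12 := (Delta2 Delta).

Let theta_l : {rmorphism H \ox H -> H \ox H \ox H} := tmap Delta idfun.
Let theta_r : {rmorphism H \ox H -> H \ox H \ox H} :=
  @tassoc k H H H \o tmap idfun Delta.
Let theta_s : {rmorphism H \ox H \ox H -> H \ox H \ox H} :=
  tmap (@tswap k H H) idfun.

Let theta_lE h : theta_l (Delta h) = D12 h.
Proof. by []. Qed.
Let theta_rE h : theta_r (Delta h) = D12 h.
Proof. exact: (enveloping_coassoc H_env Delta_cop). Qed.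

Lemma swap12_Delta1 (u : H \ox H) :
  tmap (@tswap k H H) idfun (tmap Delta idfun u) = tmap Delta idfun u.
Proof.
elim/otimes_ind: u => [|x y|u v IHu IHv]; first by rewrite !raddf0.
  by rewrite !tmapE /= (enveloping_cocomm H_env Delta_cop).
by rewrite !raddfD /= IHu IHv.
Qed.

Let theta_sE h : theta_s (D12 h) = D12 h.
Proof. exact: swap12_Delta1. Qed.

Let astlE := @ast_lE k H Delta A ast ast_pseudo.
Let astrE := ast_rE H_env Delta_cop ast_pseudo.

Lemma ast_l_balanced (y : A) : sbalanced Delta (fun beta x =>
  (beta \ox 1) *: sext_map D12 theta_l (ast x y)).
Proof.
split=> [b b' x|b x x'|b r x]; first by rewrite otimesDl scalerDl.
  by rewrite (pseudoDl ast_pseudo) (sext_mapD theta_lE) scalerDr.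
rewrite -[y in RHS]scale1r (pseudoZ ast_pseudo) (sext_mapZ theta_lE) scalerA.
by rewrite /theta_l /= tmapE /= otimesM mulr1.
Qed.

Lemma ast_r_balanced (x : A) : sbalanced Delta (fun beta y =>
  tassoc (1 \ox beta) *: sext_map D12 theta_r (ast x y)).
Proof.
split=> [b b' y|b y y'|b r y]; first by rewrite otimesDr rmorphD scalerDl.
  by rewrite (pseudoDr ast_pseudo) (sext_mapD theta_rE) scalerDr.
rewrite -[x in RHS]scale1r (pseudoZ ast_pseudo) (sext_mapZ theta_rE) scalerA /=.
by rewrite tmapE /= -rmorphM /= otimesM mulr1.
Qed.

Lemma ast_lDl u v y : ast_l ast (u + v) y = ast_l ast u y + ast_l ast v y.
Proof. exact: (sext_liftD (ast_l_balanced y)). Qed.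

Lemma ast_rDr x u v : ast_r ast x (u + v) = ast_r ast x u + ast_r ast x v.
Proof. exact: (sext_liftD (ast_r_balanced x)). Qed.

Lemma ast_l0 y : ast_l ast 0 y = 0.
Proof. exact: (sext_lift0 (ast_l_balanced y)). Qed.

Lemma ast_r0 x : ast_r ast x 0 = 0.
Proof. exact: (sext_lift0 (ast_r_balanced x)). Qed.

Lemma ast_lDr u y y' : ast_l ast u (y + y') = ast_l ast u y + ast_l ast u y'.
Proof.
elim/sexto_ind: u => [|b x|u v IHu IHv]; first by rewrite !ast_l0 addr0.
  by rewrite !astlE (pseudoDr ast_pseudo) (sext_mapD theta_lE) scalerDr.
by rewrite !ast_lDl IHu IHv addrACA.
Qed.

Lemma ast_rDl x x' v : ast_r ast (x + x') v = ast_r ast x v + ast_r ast x' v.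
Proof.
elim/sexto_ind: v => [|b y|u v IHu IHv]; first by rewrite !ast_r0 addr0.
  by rewrite !astrE (pseudoDl ast_pseudo) (sext_mapD theta_rE) scalerDr.
by rewrite !ast_rDr IHu IHv addrACA.
Qed.

Lemma ast_lZ h g l u y :
  ast_l ast ((h \ox g) *: u) (l *: y) = (h \ox g \ox l) *: ast_l ast u y.
Proof.
elim/sexto_ind: u => [|b x|u v IHu IHv]; first by rewrite scaler0 !ast_l0 scaler0.
  rewrite scale_sexto !astlE -[x in LHS]scale1r (pseudoZ ast_pseudo).
  rewrite (sext_mapZ theta_lE) !scalerA /theta_l /= tmapE /= rmorph1.
  by rewrite !otimesM !mulr1 mul1r.
by rewrite scalerDr !ast_lDl IHu IHv scalerDr.
Qed.

Lemma ast_rZ h g l x v :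
  ast_r ast (h *: x) ((g \ox l) *: v) = (h \ox g \ox l) *: ast_r ast x v.
Proof.
elim/sexto_ind: v => [|b y|u v IHu IHv]; first by rewrite scaler0 !ast_r0 scaler0.
  rewrite scale_sexto !astrE -[y in LHS]scale1r (pseudoZ ast_pseudo).
  rewrite (sext_mapZ theta_rE) !scalerA /= tmapE /= rmorph1 -!rmorphM /=.
  by rewrite !otimesM !mulr1 mul1r -tassocE -rmorphM /= otimesM mulr1.
by rewrite scalerDr !ast_rDr IHu IHv scalerDr.
Qed.

Definition associator x y z := ast_l ast (ast x y) z - ast_r ast x (ast y z).

(** The identity for a single triple, so that it can be propagated from the basis
by linearity. *)
Definition pre_lie_at x y z :=
  associator x y z = perm12 (associator y x z).

Lemma perm12D : {morph @perm12 k H Delta A : u v / u + v}.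
Proof. exact: (sext_mapD theta_sE). Qed.

Lemma perm12Z s u : perm12 (s *: u) = theta_s s *: @perm12 k H Delta A u.
Proof. exact: (sext_mapZ theta_sE). Qed.

Lemma associatorDl x x' y z :
  associator (x + x') y z = associator x y z + associator x' y z.
Proof.
by rewrite /associator (pseudoDl ast_pseudo) ast_lDl ast_rDl opprD addrACA.
Qed.

Lemma associatorDm x y y' z :
  associator x (y + y') z = associator x y z + associator x y' z.
Proof.
rewrite /associator (pseudoDl ast_pseudo) (pseudoDr ast_pseudo).
by rewrite ast_lDl ast_rDr opprD addrACA.
Qed.

Lemma associatorDr x y z z' :
  associator x y (z + z') = associator x y z + associator x y z'.
Proof.
by rewrite /associator (pseudoDr ast_pseudo) ast_lDr ast_rDr opprD addrACA.
Qed.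

Lemma associatorZ h g l x y z :
  associator (h *: x) (g *: y) (l *: z) = (h \ox g \ox l) *: associator x y z.
Proof.
by rewrite /associator !(pseudoZ ast_pseudo) ast_lZ ast_rZ scalerBr.
Qed.

Lemma pre_lie_atZ h g l x y z :
  pre_lie_at x y z -> pre_lie_at (h *: x) (g *: y) (l *: z).
Proof.
rewrite /pre_lie_at !associatorZ perm12Z => ->.
by rewrite /theta_s /= tmapE /= tswapE.
Qed.

Lemma left_pre_lie_gen (e : bool -> A) :
  (forall x, exists h, x = h true *: e true + h false *: e false) ->
  (forall i j l, pre_lie_at (e i) (e j) (e l)) -> left_pre_lie ast.
Proof.
move=> e_gen e_pl x y z; rewrite -/(associator x y z) -/(associator y x z).
rewrite -/(pre_lie_at x y z).
have [[[h ->] [g ->]] [l ->]] := (e_gen x, e_gen y, e_gen z).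
have D1 a a' b c : pre_lie_at a b c -> pre_lie_at a' b c -> pre_lie_at (a + a') b c.
  by rewrite /pre_lie_at associatorDl associatorDm perm12D => -> ->.
have D2 a b b' c : pre_lie_at a b c -> pre_lie_at a b' c -> pre_lie_at a (b + b') c.
  by rewrite /pre_lie_at associatorDl associatorDm perm12D => -> ->.
have D3 a b c c' : pre_lie_at a b c -> pre_lie_at a b c' -> pre_lie_at a b (c + c').
  by rewrite /pre_lie_at !associatorDr perm12D => -> ->.
by apply: D1; apply: D2; apply: D3; apply: pre_lie_atZ.
Qed.

Section Coefficients.
Context (e : bool -> A) (s : bool -> bool -> bool -> H \ox H).
Context (e_basis : basis2 (e true) (e false)).
Context (ast_e : forall i j, ast (e i) (e j) =
  s i j true \ox_[Delta] e true + s i j false \ox_[Delta] e false).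

(** The coefficient of [e m] in the associator of [e i], [e j], [e l]. *)
Definition associator_coef i j l m : H \ox H \ox H :=
  (s i j true \ox 1) * tmap Delta idfun (s true l m)
  + (s i j false \ox 1) * tmap Delta idfun (s false l m)
  - (tassoc (1 \ox s j l true) * tassoc (tmap idfun Delta (s i true m))
     + tassoc (1 \ox s j l false) * tassoc (tmap idfun Delta (s i false m))).

Lemma associatorE i j l : associator (e i) (e j) (e l) =
  associator_coef i j l true \ox_[D12] e true
  + associator_coef i j l false \ox_[D12] e false.
Proof.
rewrite /associator !ast_e ast_lDl ast_rDr !astlE !astrE !ast_e.
rewrite !(sext_mapD theta_lE) !(sext_mapD theta_rE).
rewrite !(sext_mapE theta_lE) !(sext_mapE theta_rE) !scalerDr !scale_sexto.
exact: sexto_collect.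
Qed.

Lemma left_pre_lie_coef : left_pre_lie ast <->
  forall i j l m, associator_coef i j l m =
    tmap (@tswap k H H) idfun (associator_coef j i l m).
Proof.
split=> [pl i j l m|coefE].
  have := pl (e i) (e j) (e l).
  rewrite -/(associator _ _ _) -/(associator (e j) _ _) !associatorE perm12D.
  rewrite !(perm12E H_env Delta_cop) => /(sext_basis_inj e_basis) [? ?].
  by case: m.
apply: (@left_pre_lie_gen e) => [x|i j l].
  have [xi1 [xi2 [[_ _ xE] _]]] := basis2_coord e_basis.
  by exists (fun i => if i then xi1 x else xi2 x); apply: xE.
rewrite /pre_lie_at !associatorE perm12D !(perm12E H_env Delta_cop).
by rewrite -!coefE.
Qed.
End Coefficients.
End PseudoAssociator.

(** * Rank two *)

(** The basis is indexed by booleans, [true] standing for [e1]. *)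
Definition structure_constants (T : Type) (zero t1 t2 a b c d : T) (i j m : bool) : T :=
  match i, j, m with
  | true, true, true => t1 | true, true, false => zero
  | true, false, true => a | true, false, false => b
  | false, true, true => c | false, true, false => d
  | false, false, true => zero | false, false, false => t2
  end.

Section RankTwo.
Context (k : fieldType) (k_char0 : [pchar k] =i pred0).
Context (delta : lmodType k) (br : delta -> delta -> delta).
Context (H : algType k) (iota : {linear delta -> H}).
Context (H_env : enveloping_algebra br iota).
Context (Delta : {lrmorphism H -> H \ox H}).
Context (Delta_cop : enveloping_coproduct iota Delta).
Context (P : lmodType H) (e1 e2 : P) (P_basis : basis2 e1 e2).
Context (ast : P -> P -> sext Delta P) (ast_pseudo : pseudoproduct ast).
Context (t1 t2 : k) (t1_neq0 : t1 != 0) (t2_neq0 : t2 != 0).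
Context (ast11 : ast e1 e1 = t1%:A \ox 1 \ox_[Delta] e1).
Context (ast22 : ast e2 e2 = t2%:A \ox 1 \ox_[Delta] e2).

Lemma associator_coef_constants (gamma : bool -> bool -> bool -> k) i j l m :
  associator_coef Delta (fun i j m => gamma i j m *: 1) i j l m =
  (gamma i j true * gamma true l m + gamma i j false * gamma false l m
   - (gamma j l true * gamma i true m + gamma j l false * gamma i false m)) *: 1.
Proof.
have ring_constants (R : algType k) (x y x' y' z w z' w' : k) :
    (x *: 1) * (y *: 1) + (x' *: 1) * (y' *: 1)
      - ((z *: 1) * (w *: 1) + (z' *: 1) * (w' *: 1)) =
    (x * y + x' * y' - (z * w + z' * w')) *: 1 :> R.
  by rewrite -!scalerAl !mul1r !scalerA -!scalerDl -scalerBl.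
rewrite /associator_coef !otimes_constant !Delta1_constant !Delta2_constant.
by rewrite !tassoc_constant; apply: ring_constants.
Qed.

Let e (i : bool) : P := if i then e1 else e2.

Let sexto0 (x : P) : 0 \ox_[Delta] x = 0.
Proof. exact: tpure0l. Qed.

Let ast_e a b c d :
  ast e1 e2 = a \ox_[Delta] e1 + b \ox_[Delta] e2 ->
  ast e2 e1 = c \ox_[Delta] e1 + d \ox_[Delta] e2 ->
  forall i j, ast (e i) (e j) =
    structure_constants 0 (t1 *: 1) (t2 *: 1) a b c d i j true \ox_[Delta] e true
    + structure_constants 0 (t1 *: 1) (t2 *: 1) a b c d i j false \ox_[Delta] e false.
Proof.
move=> ast12 ast21 [] [] //=; rewrite ?ast11 ?ast22 sexto0 ?addr0 ?add0r;
  by rewrite -scale_otimesl.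
Qed.

Lemma left_pre_lie_of_table q : q \in pre_lie_table t1 t2 ->
  ast e1 e2 = (q.1.1.1 *: 1) \ox_[Delta] e1 + (q.1.1.2 *: 1) \ox_[Delta] e2 ->
  ast e2 e1 = (q.1.2 *: 1) \ox_[Delta] e1 + (q.2 *: 1) \ox_[Delta] e2 ->
  left_pre_lie ast.
Proof.
case: q => [[[x y] z] w] /= q_in ast12 ast21.
pose gamma := structure_constants 0 t1 t2 x y z w.
have gammaE i j : ast (e i) (e j) = (gamma i j true *: 1) \ox_[Delta] e true
    + (gamma i j false *: 1) \ox_[Delta] e false.
  by rewrite (ast_e ast12 ast21); case: i j => [] []; rewrite /= ?scale0r.
apply/(left_pre_lie_coef H_env Delta_cop ast_pseudo P_basis
  (s := fun i j m => gamma i j m *: 1) gammaE) => i j l m.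
rewrite !(associator_coef_constants gamma) swap12_constant; congr (_ *: _).
have two0 : 2 != 0 :> k by rewrite ((pcharf0P k).1 k_char0).
move: q_in; rewrite /gamma {gamma gammaE} !inE.
do 7?[case/orP]; move=> /eqP[-> -> -> ->];
  by case: i j l m => [] [] [] []; rewrite /=; field.
Qed.

Let symmetric_remainder (t : k) (u : H \ox H) (w : H \ox H \ox H) :
  t *: tmap Delta idfun u - w =
    tmap (@tswap k H H) idfun (t *: tmap Delta idfun u - w) ->
  tmap (@tswap k H H) idfun w = w.
Proof.
by rewrite raddfB /= linearZ /= (swap12_Delta1 H_env Delta_cop) => /addrI/oppr_inj.
Qed.

Lemma table_of_left_pre_lie : left_pre_lie ast ->
  exists2 q, q \in pre_lie_table t1 t2 &
    ast e1 e2 = (q.1.1.1 *: 1) \ox_[Delta] e1 + (q.1.1.2 *: 1) \ox_[Delta] e2 /\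
    ast e2 e1 = (q.1.2 *: 1) \ox_[Delta] e1 + (q.2 *: 1) \ox_[Delta] e2.
Proof.
have [a [b ast12]] := sext_basis_gen P_basis (ast e1 e2).
have [c [d ast21]] := sext_basis_gen P_basis (ast e2 e1).
have astE := ast_e ast12 ast21.
move/(left_pre_lie_coef H_env Delta_cop ast_pseudo P_basis (e := e) astE) => coefE.
have [eps [epsL eps1 epsM eps_iota]] := enveloping_counit H_env.
have [||||||q q_in [aE bE cE dE]] := coefficients_classification H_env Delta_cop
  epsL eps1 epsM eps_iota k_char0 (a := a) (b := b) (c := c) (d := d) t1_neq0 t2_neq0.
- have := coefE true true false false; rewrite /associator_coef /=.
  rewrite !constantsE !otimes0l !raddf0 !(mul0r, mulr0) addr0 add0r.
  by rewrite -[(t1 *: 1) * _]scalerAl mul1r; apply: symmetric_remainder.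
- have := coefE false false true true; rewrite /associator_coef /=.
  rewrite !constantsE !otimes0l !raddf0 !(mul0r, mulr0) addr0 add0r.
  by rewrite -[(t2 *: 1) * _]scalerAl mul1r; apply: symmetric_remainder.
- have := coefE true false true true; rewrite /associator_coef /= /mixed_eq.
  rewrite !constantsE otimes0r raddf0 mul0r addr0 -!scalerAr -!scalerAl !mulr1 mul1r.
  by rewrite opprD addrA.
- have := coefE false true false false; rewrite /associator_coef /= /mixed_eq.
  rewrite !constantsE otimes0r raddf0 mul0r add0r -!scalerAr -!scalerAl !mulr1 mul1r.
  by rewrite ![_ * _ + t2 *: _]addrC opprD addrA.
- have := coefE true false true false; rewrite /associator_coef /= /action_eq.
  by rewrite !constantsE !raddf0 otimes0r raddf0 !(mul0r, mulr0, addr0, add0r)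
    -scalerAl mul1r.
- have := coefE false true false true; rewrite /associator_coef /= /action_eq.
  by rewrite !constantsE !raddf0 otimes0r raddf0 !(mul0r, mulr0, addr0, add0r)
    -scalerAl mul1r.
by exists q => //; rewrite ast12 ast21 aE bE cE dE.
Qed.

End RankTwo.

Unset Implicit Arguments.

Theorem theorem3p11
    (k : closedFieldType) (k_char0 : [pchar k] =i pred0)
    (delta : vectType k) (br : delta -> delta -> delta)
    (br_lie : lie_bracket br)
    (H : algType k) (iota : {linear delta -> H})
    (H_env : enveloping_algebra br iota)
    (Delta : {lrmorphism H -> H \ox H})
    (Delta_cop : enveloping_coproduct iota Delta)
    (P : lmodType H) (e1 e2 : P) (P_basis : basis2 e1 e2)
    (ast : P -> P -> sext Delta P) (ast_pseudo : pseudoproduct ast)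
    (t1 t2 : k) (t1_neq0 : t1 != 0) (t2_neq0 : t2 != 0)
    (ast11 : ast e1 e1 = t1%:A \ox 1 \ox_[Delta] e1)
    (ast22 : ast e2 e2 = t2%:A \ox 1 \ox_[Delta] e2) :
  left_pre_lie ast <->
     (ast e1 e2 = 0 /\
      ast e2 e1 = 0)
  \/ (ast e1 e2 = t1%:A \ox 1 \ox_[Delta] e2 /\
      ast e2 e1 = t2%:A \ox 1 \ox_[Delta] e1)
  \/ (ast e1 e2 = t1%:A \ox 1 \ox_[Delta] e2 /\
      ast e2 e1 = t1%:A \ox 1 \ox_[Delta] e2)
  \/ (ast e1 e2 = (2 * t1)%:A \ox 1 \ox_[Delta] e2 /\
      ast e2 e1 = (2^-1 * t2)%:A \ox 1 \ox_[Delta] e1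
                + t1%:A \ox 1 \ox_[Delta] e2)
  \/ (ast e1 e2 = t2%:A \ox 1 \ox_[Delta] e1 /\
      ast e2 e1 = t2%:A \ox 1 \ox_[Delta] e1)
  \/ (ast e1 e2 = t2%:A \ox 1 \ox_[Delta] e1 /\
      ast e2 e1 = t1%:A \ox 1 \ox_[Delta] e2)
  \/ (ast e1 e2 = t2%:A \ox 1 \ox_[Delta] e1
                + (2^-1 * t1)%:A \ox 1 \ox_[Delta] e2 /\
      ast e2 e1 = (2 * t2)%:A \ox 1 \ox_[Delta] e1)
  \/ (ast e1 e2 = t2%:A \ox 1 \ox_[Delta] e1
                + (2 * t1)%:A \ox 1 \ox_[Delta] e2 /\
      ast e2 e1 = (2 * t2)%:A \ox 1 \ox_[Delta] e1
                + t1%:A \ox 1 \ox_[Delta] e2).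
Proof.
have constE (t : k) (x : P) : (t *: 1) \ox_[Delta] x = t%:A \ox 1 \ox_[Delta] x.
  by rewrite -scale_otimesl.
have zeroE (x : P) : 0 \ox_[Delta] x = 0 by exact: tpure0l.
split=> [pl|].
  have [q] := table_of_left_pre_lie k_char0 H_env Delta_cop P_basis ast_pseudo
    t1_neq0 t2_neq0 ast11 ast22 pl.
  rewrite !inE; do 7?[case/orP]; move=> /eqP-> /= [-> ->];
    rewrite ?scale0r ?zeroE ?addr0 ?add0r ?constE;
    by do ?[by left | right].
have of_table q := left_pre_lie_of_table k_char0 H_env Delta_cop P_basis ast_pseudo
  ast11 ast22 (q := q).
do 7?[case]; move=> [ast12 ast21];
  [apply: (of_table (0, 0, 0, 0))
  |apply: (of_table (0, t1, t2, 0))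
  |apply: (of_table (0, t1, 0, t1))
  |apply: (of_table (0, 2 * t1, 2^-1 * t2, t1))
  |apply: (of_table (t2, 0, t2, 0))
  |apply: (of_table (t2, 0, 0, t1))
  |apply: (of_table (t2, 2^-1 * t1, 2 * t2, 0))
  |apply: (of_table (t2, 2 * t1, 2 * t2, t1))];
  rewrite /= ?inE ?eqxx ?orbT // ?ast12 ?ast21;
  by rewrite ?scale0r ?zeroE ?addr0 ?add0r ?constE.
Qed.
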